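(* Let $d\ge 2$ and let $X,X_1,X_2,\dots$ be i.i.d. random vectors in $\mathbb{R}^d$. Suppose that $X$ has a non-degenerate lattice distribution whose minimal subgroup is $L=H\mathbb{Z}^d$ with $|\det H|>0$. Suppose also that $\mathbb{E}[\|X\|^2]<\infty$, that $\mathbb{E}X=\mathbf{0}$, and that $M=\mathbb{E}[XX^{\top}]$ is positive-definite. Let $S_n=\sum_{i=1}^nX_i$ and $G_n=\frac1n\sum_{i=1}^nS_i$ for $n\ge1$. Then $$\lim_{n\to\infty}\frac{\log\|G_n\|}{\log n}=\frac12,\quad\text{almost surely}.$$
   Context: Vectors in $\mathbb{R}^d$ are column vectors and $\|\cdot\|$ is the Euclidean norm. Non-degenerate means not supported on any $(d-1)$-dimensional hyperplane. For $X$ with a non-degenerate lattice distribution, the minimal subgroup is the unique subgroup $L=H\mathbb{Z}^d$ of $\mathbb{R}^d$ ($H$ an invertible $d\times d$ real matrix) such that $\mathbb{P}(X\in\mathbf{b}+L)=1$ for some $\mathbf{b}\in\mathbb{R}^d$, and such that $L\subseteq L'$ whenever $\mathbb{P}(X\in\mathbf{x}+L')=1$ for some closed subgroup $L'$ of $\mathbb{R}^d$ and some $\mathbf{x}\in\mathbb{R}^d$. *)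

(* Defs.v *)
From HB Require Import structures.
From mathcomp Require Import all_boot all_order all_algebra.
From mathcomp Require Import finmap.
From mathcomp Require Import all_classical all_reals all_analysis.
Set Implicit Arguments.
Unset Strict Implicit.
Unset Printing Implicit Defensive.
Import Order.TTheory GRing.Theory Num.Theory.
Import numFieldNormedType.Exports.
Local Open Scope classical_set_scope.
Local Open Scope ring_scope.

(* The library norm on matrices is the sup norm, hence a separate Euclidean
   norm; both induce the same (product) topology on 'cV[R]_d. *)
Definition enorm (R : realType) (d : nat) (x : 'cV[R]_d) : R :=
  Num.sqrt (\sum_(i < d) x i 0 ^+ 2).

Definition borel (R : realType) (d : nat) : set (set 'cV[R]_d) :=
  <<s @open 'cV[R]_d >>.

Definition random_vector (disp : measure_display) (T : measurableType disp)
    (R : realType) (d : nat) (X : T -> 'cV[R]_d) : Prop :=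
  measurable_fun setT (X : T -> g_sigma_algebraType (@open 'cV[R]_d)).

Definition mutually_independent (disp : measure_display)
    (T : measurableType disp) (R : realType) (P : probability T R) (d : nat)
    (X : nat -> T -> 'cV[R]_d) : Prop :=
  forall (J : {fset nat}) (B : nat -> set 'cV[R]_d),
    (forall j, j \in J -> borel (B j)) ->
    P (\bigcap_(j in [set` J]) (X j @^-1` B j)) =
      (\prod_(j <- J) P (X j @^-1` B j))%E.

Definition identically_distributed (disp : measure_display)
    (T : measurableType disp) (R : realType) (P : probability T R) (d : nat)
    (X : nat -> T -> 'cV[R]_d) : Prop :=
  forall (i j : nat) (B : set 'cV[R]_d),
    borel B -> P (X i @^-1` B) = P (X j @^-1` B).

Definition iid_random_vectors (disp : measure_display)
    (T : measurableType disp) (R : realType) (P : probability T R) (d : nat)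
    (X : nat -> T -> 'cV[R]_d) : Prop :=
  [/\ forall n, random_vector (X n),
      mutually_independent P X
    & identically_distributed P X].

Definition translate (R : realType) (d : nat) (b : 'cV[R]_d)
    (L : set 'cV[R]_d) :
  set 'cV[R]_d := [set b + l | l in L].

Definition lattice_of (R : realType) (d : nat) (H : 'M[R]_d) :
  set 'cV[R]_d := range (fun z : 'cV[int]_d => H *m map_mx intr z).

(* (d-1)-dimensional affine hyperplane when a != 0 *)
Definition hyperplane (R : realType) (d : nat) (a : 'cV[R]_d) (c : R) :
  set 'cV[R]_d := [set x | (a^T *m x) 0 0 = c].

Definition closed_subgroup (R : realType) (d : nat) (L : set 'cV[R]_d) : Prop :=
  zmod_closed [in L] /\ closed L.

Definition nondegenerate_distribution (disp : measure_display)
    (T : measurableType disp)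
    (R : realType) (P : probability T R) (d : nat) (X : T -> 'cV[R]_d) : Prop :=
  forall (a : 'cV[R]_d) (c : R), a != 0 ->
    P (X @^-1` hyperplane a c) <> 1%E.

Definition lattice_distribution (disp : measure_display)
    (T : measurableType disp) (R : realType) (P : probability T R) (d : nat)
    (X : T -> 'cV[R]_d) : Prop :=
  exists (H : 'M[R]_d) (b : 'cV[R]_d),
    H \in unitmx /\ P (X @^-1` translate b (lattice_of H)) = 1%E.

Definition minimal_subgroup (disp : measure_display) (T : measurableType disp)
    (R : realType) (P : probability T R) (d : nat) (X : T -> 'cV[R]_d)
    (L : set 'cV[R]_d) : Prop :=
  (exists b : 'cV[R]_d, P (X @^-1` translate b L) = 1%E) /\
  (forall (L' : set 'cV[R]_d) (x : 'cV[R]_d),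
     closed_subgroup L' -> P (X @^-1` translate x L') = 1%E -> L `<=` L').

(* E[X X^T]; the entries are finite as soon as E[|X|^2] is, so [fine] then
   loses nothing *)
Definition second_moment_mx (disp : measure_display) (T : measurableType disp)
    (R : realType) (P : probability T R) (d : nat) (X : T -> 'cV[R]_d) :
  'M[R]_d :=
  \matrix_(i, j) fine ('E_P[fun w => ((X w *m (X w)^T) i j)%R])%E.

Definition positive_definite (R : realType) (d : nat) (M : 'M[R]_d) : Prop :=
  M^T = M /\ forall v : 'cV[R]_d, v != 0 -> 0 < (v^T *m M *m v) 0 0.

(* X 0 plays no role in the walk: the steps are X 1, X 2, and so on. *)
Definition walk (T : Type) (R : realType) (d : nat) (X : nat -> T -> 'cV[R]_d)
    (n : nat) (w : T) : 'cV[R]_d := \sum_(1 <= i < n.+1) X i w.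

Definition centre_of_mass (T : Type) (R : realType) (d : nat)
    (X : nat -> T -> 'cV[R]_d) (n : nat) (w : T) : 'cV[R]_d :=
  n%:R^-1 *: \sum_(1 <= i < n.+1) walk X i w.

(* Main.v *)
Require Import Defs.
From HB Require Import structures.
From mathcomp Require Import all_boot all_order all_algebra.
From mathcomp Require Import finmap.
From mathcomp Require Import all_classical all_reals all_analysis.
From mathcomp Require Import measurable_realfun.
From mathcomp Require Import ring lra zify.
Set Implicit Arguments.
Unset Strict Implicit.
Unset Printing Implicit Defensive.
Import Order.TTheory GRing.Theory Num.Theory.
Import numFieldNormedType.Exports.
Local Open Scope classical_set_scope.
Local Open Scope ring_scope.

(** Both bounds n^(1/2 - eta) <= |G_n| <= n^(1/2 + eta) hold almost surely for
    all large n, for every eta > 0; dividing logarithms gives the theorem.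

    Upper bound.  The steps are orthogonal in L^2, so the square of a partial
    sum over any of m consecutive indices has mean of order m.  Cutting [0, n]
    along the dyadic tree of intervals bounds every partial sum at once by the
    sum of the squared increments over the nodes of the tree (the
    Rademacher-Menshov device, [increment_le_dyadic]); this costs only powers of
    log n.  Hence almost surely max over m <= n of |S_m| is at most
    n^(1/2 + eta) for large n ([ae_walk_growth]), and G_n is an average of
    S_1, ..., S_n.

    Lower bound.  Two coordinates suffice.  Near the origin, the
    characteristic function phi of these two coordinates satisfies
    |phi(t)|^2 <= exp(-c |t|^2), by the positive covariance
    ([characteristic_decay]).  As n G_n is the sum of (n - j + 1) X_j,
    independence gives a Gaussian bound on the characteristic function of G_n
    up to frequencies of order one.  Integrating it against a Fejer kernel,
    here a finite sum over a square grid of frequencies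
    ([small_square_prob]), gives
    P(both coordinates of G_n are at most x sqrt n) <= C (x^2 + 1/n)
    ([small_centre_of_mass_prob]).  The scales x sqrt n used below tend to
    infinity and thus correspond to frequencies near the origin.

    This probability is not summable over n when x = n^(-eta), but it is along
    the checkpoints n = k^p with x = k^(-3/4): the square in x^2, which comes
    from working in the plane, makes the sum that of k^(-3/2).  Between k^p and
    (k + 1)^p the average G_n moves by at most a fraction of order 1/k of
    max |S_m|, that is by k^(-1 + small) sqrt n, which is negligible with
    respect to k^(-3/4) sqrt n ([average_lower_between]).  So
    |G_n| >= n^(1/2 - 1/p) for large n, and p is arbitrary. *)


(** * Real-valued expectations *)

Lemma measurable_cos_sin (R : realType) (disp : measure_display)
    (T : measurableType disp) (f : T -> R) :
  measurable_fun setT f ->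
  measurable_fun setT (fun x => cos (f x)) /\
  measurable_fun setT (fun x => sin (f x)).
Proof.
move=> mf; split.
  apply: measurableT_comp mf; apply: continuous_measurable_fun.
  exact: continuous_cos.
apply: measurableT_comp mf; apply: continuous_measurable_fun.
exact: continuous_sin.
Qed.

Lemma measurable_le_set (R : realType) (disp : measure_display)
    (T : measurableType disp) (f g : T -> R) :
  measurable_fun setT f -> measurable_fun setT g ->
  measurable [set w | f w <= g w].
Proof.
move=> mf mg; rewrite -[X in measurable X]setTI.
have := measurable_fun_ler mf mg; move=> /(_ measurableT [set true]).
rewrite (_ : _ @^-1` _ = [set w | f w <= g w]); first exact.
by apply/seteqP; split => w /=.
Qed.

Section expectation.
Context (R : realType) (disp : measure_display) (T : measurableType disp).
Variable P : probability T R.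
Implicit Types f g : T -> R.

Definition integrableR f := P.-integrable setT (EFin \o f).
(** Expectation as a real number rather than an extended one; it is meaningful
    for [integrableR] functions. *)
Definition Ex f : R := \int[P]_w f w.

Lemma integrableR_measurable f : integrableR f -> measurable_fun setT f.
Proof. by move=> /integrableP[/measurable_EFinP]. Qed.

Lemma integrableRD f g : integrableR f -> integrableR g ->
  integrableR (fun w => f w + g w).
Proof. by move=> fi gi; exact: (integrableD _ fi gi). Qed.

Lemma integrableRB f g : integrableR f -> integrableR g ->
  integrableR (fun w => f w - g w).
Proof. by move=> fi gi; exact: (integrableB _ fi gi). Qed.

Lemma integrableRZ (k : R) f : integrableR f -> integrableR (fun w => k * f w).
Proof. by move=> fi; exact: (integrableZl _ k fi). Qed.

Lemma integrableR_cst (k : R) : integrableR (fun=> k).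
Proof. exact: finite_measure_integrable_cst. Qed.

Lemma integrableR_sum I (s : seq I) (h : I -> T -> R) :
  (forall i, integrableR (h i)) -> integrableR (fun w => \sum_(i <- s) h i w).
Proof.
move=> hi; elim: s => [|i s IH].
  by under [X in integrableR X]eq_fun do rewrite big_nil; exact: integrableR_cst.
by under [X in integrableR X]eq_fun do rewrite big_cons; exact: integrableRD.
Qed.

Lemma integrableR_le f g : measurable_fun setT f -> integrableR g ->
  (forall w, `|f w| <= g w) -> integrableR f.
Proof.
move=> mf gi fg; apply: (le_integrable _ _ _ gi) => //; first exact/measurable_EFinP.
by move=> w _; rewrite /= lee_fin (le_trans (fg w))// ler_norm.
Qed.

Lemma integrableR_bounded f (K : R) : measurable_fun setT f ->
  (forall w, `|f w| <= K) -> integrableR f.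
Proof. by move=> mf fK; exact: (integrableR_le mf (integrableR_cst K)). Qed.

Lemma integrableR_mulbounded f g (K : R) : measurable_fun setT g ->
  (forall w, `|g w| <= K) -> integrableR f -> integrableR (fun w => f w * g w).
Proof.
move=> mg gK fi; apply: (@integrableR_le _ (fun w => K * `|f w|)).
- by apply: measurable_funM => //; exact: integrableR_measurable.
- by apply: integrableRZ; exact: integrable_norm.
- by move=> w; rewrite normrM mulrC ler_wpM2r.
Qed.

Lemma ExD f g : integrableR f -> integrableR g ->
  Ex (fun w => f w + g w) = Ex f + Ex g.
Proof. exact: RintegralD. Qed.

Lemma ExB f g : integrableR f -> integrableR g ->
  Ex (fun w => f w - g w) = Ex f - Ex g.
Proof. exact: RintegralB. Qed.

Lemma ExZ (k : R) f : integrableR f -> Ex (fun w => k * f w) = k * Ex f.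
Proof. exact: RintegralZl. Qed.

Lemma Ex_cst (k : R) : Ex (fun=> k) = k.
Proof.
rewrite /Ex Rintegral_cst//; have -> : fine (P setT) = 1 by rewrite probability_setT.
by rewrite mulr1.
Qed.

Lemma Ex_sum I (s : seq I) (h : I -> T -> R) : (forall i, integrableR (h i)) ->
  Ex (fun w => \sum_(i <- s) h i w) = \sum_(i <- s) Ex (h i).
Proof.
move=> hi; elim: s => [|i s IH].
  by under [in LHS]eq_fun do rewrite big_nil; rewrite Ex_cst big_nil.
under [in LHS]eq_fun do rewrite big_cons.
by rewrite ExD ?IH ?big_cons//; exact: integrableR_sum.
Qed.

Lemma le_Ex f g : integrableR f -> integrableR g -> (forall w, f w <= g w) ->
  Ex f <= Ex g.
Proof. by move=> fi gi fg; exact: le_Rintegral. Qed.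

Lemma Ex_ge0 f : (forall w, 0 <= f w) -> 0 <= Ex f.
Proof. by move=> f0; exact: Rintegral_ge0. Qed.

Lemma Ex_norm f : integrableR f -> `|Ex f| <= Ex (fun w => `|f w|).
Proof. by move=> fi; exact: le_normr_Rintegral. Qed.

Lemma EFin_Ex f : integrableR f -> ((Ex f)%:E = \int[P]_w (f w)%:E)%E.
Proof. by move=> fi; rewrite fineK//; exact: integrable_fin_num. Qed.

Lemma indic_norm_le1 (A : set T) w : `|\1_A w : R| <= 1.
Proof. by rewrite indicE; case: (_ \in _); rewrite ?normr1 ?normr0. Qed.

Lemma integrableR_indic (A : set T) : measurable A -> integrableR (\1_A).
Proof. by move=> mA; exact: integrable_indic. Qed.

Lemma Ex_indic (A : set T) : measurable A -> Ex (\1_A) = fine (P A).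
Proof. by move=> mA; rewrite /Ex /Rintegral integral_indic// setIT. Qed.

(** Markov's inequality, without normalising by the threshold. *)
Lemma prob_le_Ex (A : set T) f (a : R) : measurable A -> integrableR f ->
  (forall w, 0 <= f w) -> (forall w, A w -> a <= f w) ->
  fine (P A) * a <= Ex f.
Proof.
move=> mA fi f0 Aa; rewrite -Ex_indic// mulrC -ExZ; last exact: integrableR_indic.
apply: le_Ex => //; first by apply: integrableRZ; exact: integrableR_indic.
move=> w; rewrite indicE; case: (boolP (w \in A)) => wA; last by rewrite mulr0.
by rewrite mulr1 Aa//; exact/set_mem.
Qed.

Lemma integrableR_mul (f g : T -> R) :
  measurable_fun setT f -> measurable_fun setT g ->
  integrableR (fun w => f w ^+ 2) -> integrableR (fun w => g w ^+ 2) ->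
  integrableR (fun w => f w * g w).
Proof.
move=> mf mg if2 ig2.
apply: (@integrableR_le _ (fun w => f w ^+ 2 + g w ^+ 2)).
- exact: measurable_funM.
- exact: integrableRD.
- move=> w; rewrite normrM -(real_normK (num_real (f w))) -(real_normK (num_real (g w))).
  have := normr_ge0 (f w); have := normr_ge0 (g w); nra.
Qed.

Lemma integrableR_of_sqr (f : T -> R) : measurable_fun setT f ->
  integrableR (fun w => f w ^+ 2) -> integrableR f.
Proof.
move=> mf if2.
apply: (@integrableR_le _ (fun w => f w ^+ 2 + 1)) => //.
  by apply: integrableRD => //; exact: integrableR_cst.
move=> w; rewrite -(real_normK (num_real (f w))).
have := normr_ge0 (f w); nra.
Qed.

Lemma Ex_cvg (f_ : nat -> T -> R) f g :
  (forall n, measurable_fun setT (f_ n)) -> measurable_fun setT f ->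
  integrableR g -> (forall n w, `|f_ n w| <= g w) ->
  (forall w, f_ n w @[n --> \oo] --> f w) ->
  Ex (f_ n) @[n --> \oo] --> Ex f.
Proof.
move=> mf_ mf gi fg cf.
have [|||||fi _] := @dominated_convergence _ _ _ P setT measurableT
  (fun n => EFin \o f_ n) (EFin \o f) (EFin \o g).
- by move=> n; exact/measurable_EFinP.
- exact/measurable_EFinP.
- by apply: aeW => w _; apply: cvg_EFin => //; [exact: nearW|exact: cf].
- exact: gi.
- by apply: aeW => w n _; rewrite /= lee_fin.
rewrite -(EFin_Ex fi) => /fine_cvg.
by [].
Qed.

End expectation.

(** * Products of functions of independent vectors *)

Lemma measurable_coord (R : realType) (d : nat) (i : 'I_d) :
  measurable_fun [set: g_sigma_algebraType (@open 'cV[R]_d)]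
    (fun x : 'cV[R]_d => x i 0).
Proof.
apply: (measurability _ (RGenOpens.measurableE R)).
move=> _ [_ [a [b ->] <-]]; rewrite setTI.
apply: sub_sigma_algebra.
have /continuousP := @coord_continuous R d 1 i 0.
by apply; exact: interval_open.
Qed.

Section transfer.
Context (R : realType) (disp : measure_display) (T : measurableType disp).
Variable P : probability T R.
Context (disp' : measure_display) (E : measurableType disp').

Import HBSimple HBNNSimple.

Lemma Ex_transfer_nnsfun (Y Y' : T -> E) (U : T -> R) (c : R) (g : {nnsfun E >-> R}) :
  measurable_fun setT Y -> measurable_fun setT Y' -> integrableR P U ->
  (forall B, measurable B ->
    Ex P (fun w => U w * \1_B (Y w)) = c * fine (P (Y' @^-1` B))) ->
  Ex P (fun w => U w * g (Y w)) = c * Ex P (g \o Y').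
Proof.
move=> mY mY' iU UB.
have gE x : g x = \sum_(y <- fset_set (range g)) y * \1_(g @^-1` [set y]) x.
  by rewrite fimfunE fsbig_finite.
have mB y : measurable (g @^-1` [set y]) by exact: measurable_funPTI.
have mi y : measurable_fun setT (fun w => \1_(g @^-1` [set y]) (Y w) : R).
  by apply: measurableT_comp mY.
have mi' y : measurable_fun setT (fun w => \1_(g @^-1` [set y]) (Y' w) : R).
  by apply: measurableT_comp mY'.
have iY y : integrableR P (fun w => U w * \1_(g @^-1` [set y]) (Y w)).
  by apply: (@integrableR_mulbounded _ _ _ _ _ _ 1) => // w; exact: indic_norm_le1.
have iY' y : integrableR P (fun w => \1_(g @^-1` [set y]) (Y' w)).
  by apply: (@integrableR_bounded _ _ _ _ _ 1) => // w; exact: indic_norm_le1.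
have -> : (fun w => U w * g (Y w)) = fun w =>
    \sum_(y <- fset_set (range g)) y * (U w * \1_(g @^-1` [set y]) (Y w)).
  apply/funext => w; rewrite gE mulr_sumr; apply: eq_bigr => y _.
  by rewrite mulrCA.
rewrite Ex_sum; last by move=> y; apply: integrableRZ.
have -> : g \o Y' = fun w =>
    \sum_(y <- fset_set (range g)) y * \1_(g @^-1` [set y]) (Y' w).
  by apply/funext => w /=; rewrite gE.
rewrite Ex_sum; last by move=> y; apply: integrableRZ.
rewrite mulr_sumr; apply: eq_bigr => y _.
rewrite !ExZ// UB// mulrCA; congr (_ * (_ * _)).
rewrite -Ex_indic//.
by rewrite -[X in measurable X]setTI; exact: mY'.
Qed.

Lemma Ex_transfer_ge0 (Y Y' : T -> E) (U : T -> R) (c : R) (f : E -> R) :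
  measurable_fun setT Y -> measurable_fun setT Y' -> measurable_fun setT f ->
  integrableR P U -> (forall x, 0 <= f x) ->
  integrableR P (fun w => U w * f (Y w)) -> integrableR P (f \o Y') ->
  (forall B, measurable B ->
    Ex P (fun w => U w * \1_B (Y w)) = c * fine (P (Y' @^-1` B))) ->
  Ex P (fun w => U w * f (Y w)) = c * Ex P (f \o Y').
Proof.
move=> mY mY' mf iU f0 iUf if' UB.
have mfE : measurable_fun [set: E] (EFin \o f) by exact/measurable_EFinP.
pose g n := nnsfun_approx measurableT mfE n.
have gf n x : 0 <= g n x <= f x.
  apply/andP; split; first exact: fun_ge0.
  rewrite -lee_fin /g nnsfun_approxE.
  by apply: (@le_approx _ _ _ setT (EFin \o f)) => // y _; rewrite lee_fin.
have cg x : g n x @[n --> \oo] --> f x.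
  have := @cvg_nnsfun_approx _ _ _ _ measurableT _ mfE (fun x _ => f0 x) x Logic.I.
  by move=> /fine_cvg.
have mU := integrableR_measurable iU.
have c1 : Ex P (fun w => U w * g n (Y w)) @[n --> \oo] -->
    Ex P (fun w => U w * f (Y w)).
  apply: (@Ex_cvg _ _ _ _ _ _ (fun w => `|U w * f (Y w)|)).
  - move=> n; apply: measurable_funM => //.
    by apply: measurableT_comp mY => //; exact: measurable_funP.
  - by apply: measurable_funM => //; exact: measurableT_comp mY.
  - exact: integrable_norm.
  - move=> n w; have /andP[g0 gfn] := gf n (Y w).
    by rewrite !normrM ler_wpM2l// !ger0_norm.
  - by move=> w; apply: cvgMr; exact: cg.
have c2 : c * Ex P (g n \o Y') @[n --> \oo] --> c * Ex P (f \o Y').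
  apply: cvgMr; apply: (@Ex_cvg _ _ _ _ _ _ (f \o Y')).
  - by move=> n; apply: measurableT_comp mY' => //; exact: measurable_funP.
  - exact: measurableT_comp mY'.
  - exact: if'.
  - by move=> n w; have /andP[g0 gfn] := gf n (Y' w); rewrite /= ger0_norm.
  - by move=> w /=; exact: cg.
apply: (cvg_unique _ c1).
  exact: norm_hausdorff.
suff -> : (fun n => Ex P (fun w => U w * g n (Y w))) =
  (fun n => c * Ex P (g n \o Y')) by [].
by apply/funext => n; exact: Ex_transfer_nnsfun.
Qed.

(** How independence is used throughout: a factorisation tested only on the
    indicators of [Y] extends to all functions of [Y].  With [U = 1] it says
    that [Y] and [Y'] have the same law; with [U] a function of other steps it
    says that [U] and [Y] are uncorrelated.  Keeping [U] real-valued avoids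
    generated sigma-algebras altogether. *)
Lemma Ex_transfer (Y Y' : T -> E) (U : T -> R) (c : R) (f : E -> R) :
  measurable_fun setT Y -> measurable_fun setT Y' -> measurable_fun setT f ->
  integrableR P U ->
  integrableR P (fun w => U w * f (Y w)) -> integrableR P (f \o Y') ->
  (forall B, measurable B ->
    Ex P (fun w => U w * \1_B (Y w)) = c * fine (P (Y' @^-1` B))) ->
  Ex P (fun w => U w * f (Y w)) = c * Ex P (f \o Y').
Proof.
move=> mY mY' mf iU iUf if' UB.
have fE x : f x = f^\+ x - f^\- x by rewrite -{1}(funrposBneg f).
have mU := integrableR_measurable iU.
have posneg_norm x : `|f x| = f^\+ x + f^\- x.
  by have := congr1 (fun h => h x) (funrposDneg f).
have le_pos x : `|f^\+ x| <= `|f x|.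
  by rewrite posneg_norm ger0_norm ?lerDl.
have le_neg x : `|f^\- x| <= `|f x|.
  by rewrite posneg_norm ger0_norm ?lerDr.
have part (h : E -> R) : measurable_fun setT h -> (forall x, 0 <= h x) ->
    (forall x, `|h x| <= `|f x|) ->
  [/\ integrableR P (fun w => U w * h (Y w)), integrableR P (h \o Y') &
    Ex P (fun w => U w * h (Y w)) = c * Ex P (h \o Y')].
  move=> mh h0 hf.
  have i1 : integrableR P (fun w => U w * h (Y w)).
    apply: (integrableR_le _ (integrable_norm iUf)).
      by apply: measurable_funM => //; exact: measurableT_comp mY.
    by move=> w /=; rewrite !normrM ler_wpM2l.
  have i2 : integrableR P (h \o Y').
    apply: (integrableR_le _ (integrable_norm if')).
      exact: measurableT_comp mY'.
    by move=> w /=.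
  by split => //; exact: Ex_transfer_ge0.
have [i1 i1' E1] := part _ (measurable_funrpos mf) (funrpos_ge0 f) le_pos.
have [i2 i2' E2] := part _ (measurable_funrneg mf) (funrneg_ge0 f) le_neg.
have -> : (fun w => U w * f (Y w)) =
    (fun w => U w * f^\+ (Y w) - U w * f^\- (Y w)).
  by apply/funext => w; rewrite {1}fE mulrBr.
have -> : f \o Y' = (fun w => (f^\+ \o Y') w - (f^\- \o Y') w).
  by apply/funext => w; rewrite /= {1}fE.
by rewrite !ExB// E1 E2 mulrBr.
Qed.

End transfer.

Section independence.
Context (R : realType) (disp : measure_display) (T : measurableType disp).
Variable P : probability T R.
Variable d : nat.
Local Notation V := (g_sigma_algebraType (@open 'cV[R]_d)).
Variable X : nat -> T -> 'cV[R]_d.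
Hypothesis hX : iid_random_vectors P X.
Implicit Types (J : {fset nat}) (B : nat -> set 'cV[R]_d).

(** The events on which mutual independence is stated. *)
Definition cylinder J B : set T := \bigcap_(j in [set` J]) (X j @^-1` B j).

Lemma measurable_step n : measurable_fun setT (X n : T -> V).
Proof. by case: hX => mX _ _; exact: mX. Qed.

Lemma measurable_step_preimage n (B : set 'cV[R]_d) :
  borel B -> measurable (X n @^-1` B).
Proof.
by move=> mB; rewrite -[X in measurable X]setTI; exact: measurable_step.
Qed.

Lemma measurable_cylinder J B : (forall j, borel (B j)) -> measurable (cylinder J B).
Proof.
move=> mB; rewrite /cylinder bigcap_fset.
by apply: bigsetI_measurable => j _; exact: measurable_step_preimage.
Qed.

(** Adjoining one more step to a cylinder is again a cylinder; the law of the
    new step is that of step 0. *)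
Lemma prob_cylinderI J B k (B0 : set 'cV[R]_d) :
  (forall j, borel (B j)) -> borel B0 -> k \notin J ->
  fine (P (cylinder J B `&` X k @^-1` B0)) =
  fine (P (cylinder J B)) * fine (P (X 0%N @^-1` B0)).
Proof.
move=> mB mB0 kJ; case: (hX) => _ indep ident.
pose B' j := if j == k then B0 else B j.
have mB' j : borel (B' j) by rewrite /B'; case: ifP.
have neqk j : j \in J -> (j == k) = false.
  by move=> jJ; apply/negbTE; apply: contraNneq kJ => <-.
have -> : cylinder J B `&` X k @^-1` B0 = cylinder (k |` J)%fset B'.
  apply/seteqP; split => w.
    move=> [Aw Bw] j /=; rewrite in_fset1U => /orP[/eqP ->|jJ].
      by rewrite /B' eqxx.
    by rewrite /B' neqk//; exact: Aw.
  move=> Aw; split.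
    by move=> j jJ; have := Aw j; rewrite /= /B' neqk//; apply; rewrite in_fset1U jJ orbT.
  by have := Aw k; rewrite /= /B' eqxx; apply; rewrite in_fset1U eqxx.
have -> : P (cylinder (k |` J)%fset B') =
    (P (X 0%N @^-1` B0) * P (cylinder J B))%E.
  rewrite /cylinder !indep// big_fsetU1//= /B' eqxx (ident k 0%N)//; congr (_ * _)%E.
  by rewrite !big_seq; apply: eq_bigr => j jJ; rewrite neqk.
by rewrite muleC fineM// fin_num_measure//;
  [exact: measurable_cylinder|exact: measurable_step_preimage].
Qed.

Lemma Ex_step_bounded (U : T -> R) (f : V -> R) (K c : R) k :
  measurable_fun setT U -> (forall w, `|U w| <= K) ->
  measurable_fun setT f -> (forall x, `|f x| <= 1) ->
  (forall B0 : set 'cV[R]_d, borel B0 ->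
    Ex P (fun w => U w * \1_B0 (X k w)) = c * fine (P (X 0%N @^-1` B0))) ->
  Ex P (fun w => U w * f (X k w)) = c * Ex P (fun w => f (X 0%N w)).
Proof.
move=> mU UK mf f1 UB.
have mfX j : measurable_fun setT (fun w => f (X j w)).
  exact: (measurableT_comp mf (measurable_step j)).
apply: (@Ex_transfer _ _ _ P _ V (X k) (X 0%N) U c f) => //.
- exact: measurable_step.
- exact: measurable_step.
- exact: integrableR_bounded UK.
- by apply: (@integrableR_mulbounded _ _ _ _ _ _ 1) => //; exact: integrableR_bounded UK.
- by apply: (@integrableR_bounded _ _ _ _ _ 1) => [|w]; [exact: mfX|exact: f1].
Qed.

Lemma integrableR_step (f : V -> R) k : measurable_fun setT f ->
  integrableR P (fun w => f (X 0%N w)) -> integrableR P (fun w => f (X k w)).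
Proof.
move=> mf /integrableP[_ if0]; apply/integrableP; split.
  apply/measurable_EFinP; exact: (measurableT_comp mf (measurable_step k)).
apply: le_lt_trans if0.
have mfE : measurable_fun [set: V] (fun x => `|(f x)%:E|)%E.
  by apply: measurableT_comp => //; exact/measurable_EFinP.
have E j : (\int[P]_w `|(f (X j w))%:E| =
            \int[pushforward P (X j : T -> V)]_x `|(f x)%:E|)%E.
  rewrite ge0_integral_pushforward//; exact: measurable_step.
rewrite /= !E le_eqVlt; apply/orP; left; apply/eqP.
apply: eq_measure_integral;
  [exact: measurable_step|exact: measurable_step|move=> ? ? B mB _].
by case: (hX) => _ _; apply.
Qed.

Lemma Ex_step (f : V -> R) k : measurable_fun setT f ->
  integrableR P (fun w => f (X 0%N w)) ->
  Ex P (fun w => f (X k w)) = Ex P (fun w => f (X 0%N w)).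
Proof.
move=> mf if0; have ifk := integrableR_step k mf if0.
have E1 : (fun w => f (X k w)) = fun w => 1 * f (X k w).
  by apply/funext => w; rewrite mul1r.
rewrite E1 -[RHS]mul1r.
apply: (@Ex_transfer _ _ _ P _ V (X k) (X 0%N) (fun=> 1) 1 f) => //.
- exact: measurable_step.
- exact: measurable_step.
- exact: integrableR_cst.
- by rewrite -E1.
move=> B mB.
under eq_fun do rewrite mul1r.
rewrite mul1r; case: (hX) => _ _ ident; rewrite -(ident k)//.
rewrite -[RHS]Ex_indic//; exact: measurable_step_preimage.
Qed.

(** Apply [Ex_transfer] twice: first to decouple [f (X k)] from the indicators of
    [X m], then, with these as test functions, from [f (X m)]. *)
Lemma Ex_step_orthogonal (f : V -> R) m k : m != k -> measurable_fun setT f ->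
  integrableR P (fun w => f (X 0%N w)) ->
  integrableR P (fun w => f (X m w) * f (X k w)) ->
  Ex P (fun w => f (X 0%N w)) = 0 -> Ex P (fun w => f (X m w) * f (X k w)) = 0.
Proof.
move=> mk mf if0 ifmk f0.
have ifk := integrableR_step k mf if0.
under eq_fun do rewrite mulrC.
have -> : 0 = 0 * Ex P (fun w => f (X 0%N w)) by rewrite mul0r.
apply: (@Ex_transfer _ _ _ P _ V (X m) (X 0%N) (fun w => f (X k w))) => //.
- exact: measurable_step.
- exact: measurable_step.
- by under eq_fun do rewrite mulrC.
move=> B mB; rewrite mul0r.
under eq_fun do rewrite mulrC.
have mBm : measurable_fun setT (fun w => \1_B (X m w) : R).
  apply: (@measurableT_comp _ _ _ _ V _ (\1_B : V -> R)) (measurable_step m).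
  exact: measurable_indic.
rewrite (@Ex_transfer _ _ _ P _ V (X k) (X 0%N) (fun w => \1_B (X m w))
  (fine (P (X m @^-1` B))) f) ?f0 ?mulr0//.
- exact: measurable_step.
- exact: measurable_step.
- by apply: (@integrableR_bounded _ _ _ _ _ 1) => // w; exact: indic_norm_le1.
- under eq_fun do rewrite mulrC.
  by apply: (@integrableR_mulbounded _ _ _ _ _ _ 1) => // w; exact: indic_norm_le1.
move=> B0 mB0.
have cm : cylinder [fset m]%fset (fun=> B) = X m @^-1` B.
  rewrite /cylinder; apply/seteqP; split => w.
    by apply; rewrite /= inE.
  by move=> Bw j /=; rewrite inE => /eqP ->.
have := @prob_cylinderI [fset m]%fset (fun=> B) k B0 (fun=> mB) mB0.
rewrite cm inE eq_sym => /(_ mk) <-.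
rewrite -Ex_indic; last by apply: measurableI; exact: measurable_step_preimage.
by congr (Ex P _); apply/funext => w; rewrite indicI.
Qed.

Variable g : nat -> V -> R.
Hypothesis mg : forall j, measurable_fun setT (g j).

(** The exponent of a product of characters, one for each of the steps
    1, ..., n. *)
Definition phase n (w : T) : R := \sum_(j < n) g j (X j.+1 w).

(** Real and imaginary part of the product of the characteristic functions of
    the summands of [phase], multiplied as complex numbers. *)
Fixpoint charf_phase n : R * R :=
  if n is m.+1 then
    let c := Ex P (fun w => cos (g m (X 0%N w))) in
    let s := Ex P (fun w => sin (g m (X 0%N w))) in
    let: (a, b) := charf_phase m in (a * c - b * s, b * c + a * s)
  else (1, 0).

Lemma measurable_phase n : measurable_fun setT (phase n).
Proof.
apply: measurable_sum => j.
exact: (measurableT_comp (mg j) (measurable_step j.+1)).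
Qed.

Lemma phaseS n w : phase n.+1 w = phase n w + g n (X n.+1 w).
Proof. by rewrite /phase big_ord_recr. Qed.

(** The characteristic function of a sum is the product of the characteristic
    functions.  Cosine and sine of a sum are not products, so the induction
    carries both of them, together with a cylinder over the steps not yet used:
    this cylinder provides the test events for the next step. *)
Lemma Ex_phase_cylinder n J B : (forall j, borel (B j)) ->
  (forall j, j \in J -> (n < j)%N) ->
  Ex P (fun w => cos (phase n w) * \1_(cylinder J B) w) =
    (charf_phase n).1 * fine (P (cylinder J B)) /\
  Ex P (fun w => sin (phase n w) * \1_(cylinder J B) w) =
    (charf_phase n).2 * fine (P (cylinder J B)).
Proof.
elim: n J B => [|n IH] J B mB Jn.
  under eq_fun do rewrite /phase big_ord0 cos0.
  under [in X in _ /\ X]eq_fun do rewrite /phase big_ord0 sin0.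
  have mJ := measurable_cylinder J mB.
  by rewrite !ExZ ?mul1r ?mul0r ?Ex_indic//; exact: integrableR_indic.
have mJ := measurable_cylinder J mB.
have nJ : n.+1 \notin J by apply/negP => /Jn; rewrite ltnn.
have Jn' j : j \in J -> (n < j)%N by move=> /Jn /ltnW.
have [mc ms] := measurable_cos_sin (measurable_phase n).
have m1 : measurable_fun setT (\1_(cylinder J B) : T -> R) by exact: measurable_indic.
have step (h : R -> R) (C : R) (f : V -> R) :
    measurable_fun setT (fun w => h (phase n w)) -> (forall x, `|h x| <= 1) ->
    measurable_fun setT f -> (forall x, `|f x| <= 1) ->
    (forall J' B', (forall j, borel (B' j)) -> (forall j, j \in J' -> (n < j)%N) ->
      Ex P (fun w => h (phase n w) * \1_(cylinder J' B') w) =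
      C * fine (P (cylinder J' B'))) ->
    Ex P (fun w => h (phase n w) * \1_(cylinder J B) w * f (X n.+1 w)) =
    C * fine (P (cylinder J B)) * Ex P (fun w => f (X 0%N w)) /\
    integrableR P (fun w => h (phase n w) * \1_(cylinder J B) w * f (X n.+1 w)).
  move=> mh h1 mf f1 hC.
  have mU : measurable_fun setT (fun w => h (phase n w) * \1_(cylinder J B) w).
    exact: measurable_funM.
  have U1 w : `|h (phase n w) * \1_(cylinder J B) w| <= 1.
    by rewrite normrM mulr_ile1// indic_norm_le1.
  split.
    apply: (Ex_step_bounded mU U1 mf f1) => B0 mB0.
    pose B' j := if j == n.+1 then B0 else B j.
    have mB' j : borel (B' j) by rewrite /B'; case: ifP.
    have cylE : cylinder (n.+1 |` J)%fset B' = cylinder J B `&` X n.+1 @^-1` B0.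
      rewrite /cylinder bigcap_fsetU1 /B' eqxx setIC; congr (_ `&` _).
      apply: eq_bigcapr => j /= jJ; case: eqP => // jn.
      by move: nJ; rewrite -jn jJ.
    rewrite -mulrA -(prob_cylinderI mB mB0 nJ) -cylE -hC//; last first.
      by move=> j; rewrite in_fset1U => /orP[/eqP ->//|/Jn'].
    congr (Ex P _); apply/funext => w.
    rewrite -mulrA cylE indicI; congr (_ * (_ * _)).
  apply: (@integrableR_bounded _ _ _ _ _ 1) => [|w].
    by apply: measurable_funM => //; exact: (measurableT_comp mf (measurable_step n.+1)).
  by rewrite normrM mulr_ile1.
have [mgc mgs] := measurable_cos_sin (mg n).
pose Cn := charf_phase n.
have IHc J' B' : (forall j, borel (B' j)) -> (forall j, j \in J' -> (n < j)%N) ->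
    Ex P (fun w => cos (phase n w) * \1_(cylinder J' B') w) =
    Cn.1 * fine (P (cylinder J' B')) by move=> h1 h2; case: (IH J' B' h1 h2).
have IHs J' B' : (forall j, borel (B' j)) -> (forall j, j \in J' -> (n < j)%N) ->
    Ex P (fun w => sin (phase n w) * \1_(cylinder J' B') w) =
    Cn.2 * fine (P (cylinder J' B')) by move=> h1 h2; case: (IH J' B' h1 h2).
have c1 x : `|cos x : R| <= 1 by exact: cos_max.
have s1 x : `|sin x : R| <= 1 by exact: sin_max.
have [Ecc icc] := step cos _ _ mc c1 mgc (fun x => c1 _) IHc.
have [Ecs ics] := step cos _ _ mc c1 mgs (fun x => s1 _) IHc.
have [Esc isc] := step sin _ _ ms s1 mgc (fun x => c1 _) IHs.
have [Ess iss] := step sin _ _ ms s1 mgs (fun x => s1 _) IHs.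
rewrite /= -/Cn; case: Cn Ecc Ecs Esc Ess {IHc IHs} => a b /= Ecc Ecs Esc Ess.
split.
  under eq_fun do rewrite phaseS cosD mulrBl mulrAC [X in _ - X]mulrAC.
  by rewrite ExB// Ecc Ess; ring.
under eq_fun do rewrite phaseS sinD mulrDl mulrAC [X in _ + X]mulrAC.
by rewrite ExD// Esc Ecs; ring.
Qed.

Lemma charf_phaseE n :
  Ex P (fun w => cos (phase n w)) = (charf_phase n).1 /\
  Ex P (fun w => sin (phase n w)) = (charf_phase n).2.
Proof.
have mB (j : nat) : borel (setT : set 'cV[R]_d) by exact: (@measurableT _ V).
have [] := @Ex_phase_cylinder n fset0 (fun=> setT) mB; first by move=> j; rewrite inE.
have -> : cylinder fset0 (fun=> setT) = setT.
  by rewrite -subTset => w _ j.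
rewrite [P _]probability_setT /= !mulr1 => <- <-.
by split; congr (Ex P _); apply/funext => w; rewrite indicT mulr1.
Qed.

Lemma charf_phase_modulus n :
  (charf_phase n).1 ^+ 2 + (charf_phase n).2 ^+ 2 =
  \prod_(j < n) (Ex P (fun w => cos (g j (X 0%N w))) ^+ 2 +
                 Ex P (fun w => sin (g j (X 0%N w))) ^+ 2).
Proof.
elim: n => [|n IH]; first by rewrite big_ord0 /=; ring.
rewrite big_ord_recr -IH /=; case: (charf_phase n) => a b /=.
set c := Ex P _; set s := Ex P _; ring.
Qed.

Lemma Ex_cos_phase_le n :
  Ex P (fun w => cos (phase n w)) ^+ 2 <=
  \prod_(j < n) (Ex P (fun w => cos (g j (X 0%N w))) ^+ 2 +
                 Ex P (fun w => sin (g j (X 0%N w))) ^+ 2).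
Proof.
by rewrite -charf_phase_modulus (charf_phaseE n).1 lerDl sqr_ge0.
Qed.


End independence.

(** * Almost sure growth of the walk *)

(** Convergence of the series of k^(-3/2), by comparison with the telescoping
    series of 4 (k^(-1/2) - (k + 1)^(-1/2)). *)
Lemma sum_inv_sqrt3_le (R : realType) n :
  \sum_(k < n) (Num.sqrt (k.+1%:R : R) ^+ 3)^-1 <= 4.
Proof.
suff H : \sum_(k < n) (Num.sqrt (k.+1%:R : R) ^+ 3)^-1 <= 4 - 4 / Num.sqrt n.+1%:R.
  by apply: (le_trans H); rewrite gerBl divr_ge0// sqrtr_ge0.
elim: n => [|n IH]; first by rewrite big_ord0 sqrtr1 divr1 subrr.
rewrite big_ord_recr /=; apply: (le_trans (lerD IH (lexx _))).
set x := Num.sqrt (n.+1%:R : R); set y := Num.sqrt (n.+2%:R : R).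
have x1 : 1 <= x by rewrite -sqrtr1 ler_sqrt// ler1n.
have y0 : 0 < y by rewrite sqrtr_gt0.
have xy : y ^+ 2 = x ^+ 2 + 1 by rewrite !sqr_sqrtr// -[in LHS]natr1.
have x0 : 0 < x by lra.
have yx : y <= 3 / 2 * x.
  rewrite -(@ler_pXn2r _ 2)// ?nnegrE; [nra|lra|lra].
rewrite -subr_ge0 (_ : _ - _ = (4 * x ^+ 2 * (y - x) - y) / (x ^+ 3 * y)); last first.
  by field; rewrite !gt_eqF.
apply: divr_ge0; last by rewrite mulr_ge0 ?exprn_ge0// ltW.
have : (4 * x ^+ 2 * (y - x) - y) * (x + y) >= 0.
  have -> : (4 * x ^+ 2 * (y - x) - y) * (x + y) = 4 * x ^+ 2 * (y ^+ 2 - x ^+ 2) - y * x - y ^+ 2 by ring.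
  rewrite xy; nra.
by rewrite pmulr_lge0//; lra.
Qed.

Section almost_sure.
Context (R : realType) (disp : measure_display) (T : measurableType disp).
Variable P : probability T R.

(** The sum of the [Z k] has finite mean, hence is finite almost surely.  On
    indicators this is the Borel-Cantelli lemma. *)
Lemma ae_cvg0 (Z : nat -> T -> R) (B : R) :
  (forall k, integrableR P (Z k)) -> (forall k w, 0 <= Z k w) ->
  (forall n, \sum_(k < n) Ex P (Z k) <= B) ->
  {ae P, forall w, Z k w @[k --> \oo] --> (0 : R)}.
Proof.
move=> iZ Z0 sB.
pose F w := (\sum_(k <oo) (Z k w)%:E)%E.
have mZ k : measurable_fun setT (fun w => (Z k w)%:E).
  by apply/measurable_EFinP; exact: integrableR_measurable (iZ k).
have Z0' k w : (0 <= (Z k w)%:E)%E by rewrite lee_fin.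
have F0 w : (0 <= F w)%E by exact: nneseries_ge0.
have iF : P.-integrable setT F.
  apply/integrableP; split; first exact: ge0_emeasurable_sum.
  under eq_integral do rewrite gee0_abs//.
  rewrite integral_nneseries//.
  apply: (@le_lt_trans _ _ B%:E); last exact: ltry.
  apply: lime_le.
    by apply: is_cvg_nneseries => n _ _; apply: integral_ge0.
  apply: nearW => n; rewrite big_mkord.
  under eq_bigr do rewrite -EFin_Ex//.
  by rewrite sumEFin lee_fin.
have := integrable_ae measurableT iF; apply: filterS => w /(_ Logic.I) Fw.
apply: cvg_series_cvg_0; apply: nondecreasing_is_cvgn.
  by apply: nondecreasing_series => k _ _; exact: Z0.
exists (fine (F w)) => _ [n _ <-].
rewrite -lee_fin fineK// /series/= -sumEFin.
exact: (@nneseries_lim_ge _ (fun k => (Z k w)%:E)).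
Qed.

 End almost_sure.

Section maximal.
Context (R : realType) (disp : measure_display) (T : measurableType disp).
Variable P : probability T R.
Variable d : nat.
Local Notation V := (g_sigma_algebraType (@open 'cV[R]_d)).
Variable X : nat -> T -> 'cV[R]_d.
Hypothesis hX : iid_random_vectors P X.
Variable f : V -> R.
Hypothesis mf : measurable_fun setT f.

Definition increment a m (w : T) : R := \sum_(i < m) f (X (a + i).+1 w).

Lemma incrementD a m n w :
  increment a (m + n) w = increment a m w + increment (a + m) n w.
Proof.
rewrite /increment big_split_ord /=; congr (_ + _).
by apply: eq_bigr => i _; rewrite addnA.
Qed.

(** The leaves and the left children of the dyadic tree of depth [j] that starts
    at [a] are the only intervals needed to build its initial segments. *)
Fixpoint dyadic_energy j a (w : T) : R :=
  if j is i.+1 then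
    dyadic_energy i a w + dyadic_energy i (a + 2 ^ i)%N w + increment a (2 ^ i) w ^+ 2
  else increment a 1 w ^+ 2.

Lemma dyadic_energy_ge0 j a w : 0 <= dyadic_energy j a w.
Proof.
elim: j a => [|j IH] a /=; first exact: sqr_ge0.
by rewrite !addr_ge0// sqr_ge0.
Qed.

(** An initial segment of [2 ^ j] is a disjoint union of at most one dyadic
    interval per level, and Cauchy-Schwarz over the [j.+1] levels costs the
    factor.  The induction uses (x + y)^2 <= (1 + t) x^2 + (1 + 1/t) y^2 with
    t = j + 1. *)
Lemma increment_le_dyadic j a i w : (i <= 2 ^ j)%N ->
  increment a i w ^+ 2 <= j.+1%:R * dyadic_energy j a w.
Proof.
elim: j a i => [|j IH] a i.
  rewrite expn0 mul1r; case: i => [|[|//]] _ //=.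
  by rewrite /increment big_ord0 expr0n/= sqr_ge0.
move=> ij; have D1 := dyadic_energy_ge0 j a w.
have D2 := dyadic_energy_ge0 j (a + 2 ^ j) w.
have D0 := sqr_ge0 (increment a (2 ^ j) w).
have j0 : (0 : R) <= j%:R by exact: ler0n.
have [ij'|ij'] := leqP i (2 ^ j).
  apply: (le_trans (IH a i ij')); rewrite /= -![in leRHS]natr1 -natr1.
  rewrite [leRHS](_ : _ = (j%:R + 1) * dyadic_energy j a w +
    (dyadic_energy j a w + (j%:R + 1 + 1) * (dyadic_energy j (a + 2 ^ j) w +
     increment a (2 ^ j) w ^+ 2))); last by ring.
  by rewrite lerDl; apply: addr_ge0 => //; apply: mulr_ge0; [lra|exact: addr_ge0].
have -> : i = (2 ^ j + (i - 2 ^ j))%N by rewrite subnKC// ltnW.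
rewrite incrementD.
have : increment (a + 2 ^ j) (i - 2 ^ j) w ^+ 2 <= j.+1%:R * dyadic_energy j (a + 2 ^ j) w.
  by apply: IH; rewrite leq_subLR addnn -mul2n -expnS.
rewrite /= -[in leRHS]natr1 -natr1 => Hy.
set x := increment a _ w; set y := increment _ _ w in Hy *.
set A := dyadic_energy j a w in D1 *; set B := dyadic_energy j _ w in D2 Hy *.
have jp : (0 : R) < j%:R + 1 by lra.
have H : (x + y) ^+ 2 <= (j%:R + 1 + 1) * x ^+ 2 + (j%:R + 1 + 1) / (j%:R + 1) * y ^+ 2.
  rewrite -subr_ge0 [X in 0 <= X](_ : _ = ((j%:R + 1) * x - y) ^+ 2 / (j%:R + 1)); last first.
    by field; rewrite gt_eqF.
  by rewrite divr_ge0// ?sqr_ge0// ltW.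
apply: (le_trans H).
have H2 : (j%:R + 1 + 1) / (j%:R + 1) * y ^+ 2 <= (j%:R + 1 + 1) * B.
  by rewrite -mulrA ler_pM2l; [rewrite mulrC ler_pdivrMr// mulrC|lra].
apply: (le_trans (lerD (lexx _) H2)).
have : 0 <= (j%:R + 1 + 1) * A by rewrite mulr_ge0//; lra.
lra.
Qed.

Hypothesis if2 : integrableR P (fun w => f (X 0%N w) ^+ 2).
Hypothesis f0 : Ex P (fun w => f (X 0%N w)) = 0.

Let mfX k : measurable_fun setT (fun w => f (X k w)).
Proof. exact: (measurableT_comp mf (measurable_step hX k)). Qed.

Let if2X k : integrableR P (fun w => f (X k w) ^+ 2).
Proof.
apply: (@integrableR_step _ _ _ _ _ _ hX (fun x => f x ^+ 2)) => //.
exact: measurable_funX.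
Qed.

Let ifX k m : integrableR P (fun w => f (X k w) * f (X m w)).
Proof. by apply: integrableR_mul. Qed.

Lemma Ex_increment_sqr a m :
  integrableR P (fun w => increment a m w ^+ 2) /\
  Ex P (fun w => increment a m w ^+ 2) = m%:R * Ex P (fun w => f (X 0%N w) ^+ 2).
Proof.
elim: m => [|m [IH1 IH2]].
  under [X in integrableR _ X]eq_fun do rewrite /increment big_ord0 expr0n.
  under [in X in _ /\ X]eq_fun do rewrite /increment big_ord0 expr0n.
  by split; [exact: integrableR_cst|rewrite mul0r Ex_cst].
have E : (fun w => increment a m.+1 w ^+ 2) = (fun w =>
    increment a m w ^+ 2 + f (X (a + m).+1 w) ^+ 2 +
    2 * \sum_(i < m) f (X (a + i).+1 w) * f (X (a + m).+1 w)).
  apply/funext => w; rewrite /increment big_ord_recr/= -mulr_suml.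
  by ring.
have i2 : integrableR P (fun w =>
    2 * \sum_(i < m) f (X (a + i).+1 w) * f (X (a + m).+1 w)).
  by apply: integrableRZ; apply: integrableR_sum => i.
have i1 : integrableR P (fun w => increment a m w ^+ 2 + f (X (a + m).+1 w) ^+ 2).
  exact: integrableRD.
rewrite E; split; first exact: integrableRD.
rewrite !ExD// IH2 ExZ; last by apply: integrableR_sum => i.
rewrite Ex_sum//.
rewrite (@Ex_step _ _ _ _ _ _ hX (fun x => f x ^+ 2) (a + m).+1) //; last exact: measurable_funX.
rewrite big1 => [|i _]; last first.
  apply: (Ex_step_orthogonal hX) => //; last by apply: integrableR_of_sqr => //; exact: mfX.
  by rewrite eqSS eqn_add2l neq_ltn ltn_ord.
by rewrite mulr0 addr0 -natr1 mulrDl mul1r.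
Qed.

(** Each of the [j.+1] levels contributes at most the variance of [2 ^ j] steps. *)
Lemma Ex_dyadic_energy j a :
  integrableR P (dyadic_energy j a) /\
  Ex P (dyadic_energy j a) <= j.+1%:R * 2 ^+ j * Ex P (fun w => f (X 0%N w) ^+ 2).
Proof.
elim: j a => [|j IH] a.
  have [i1 e1] := Ex_increment_sqr a 1.
  by split=> //; rewrite [leLHS]e1 expr0 mulr1.
have [i1 e1] := IH a; have [i2 e2] := IH (a + 2 ^ j)%N.
have [i3 e3] := Ex_increment_sqr a (2 ^ j).
split; first by apply: integrableRD => //; exact: integrableRD.
rewrite ExD//; last exact: integrableRD.
rewrite ExD// e3 natrX exprS -[j.+2%:R]natr1.
set s2 := Ex P (fun w => f (X 0%N w) ^+ 2) in e1 e2 *.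
have s20 : 0 <= 2 ^+ j * s2.
  by apply: mulr_ge0; [exact: exprn_ge0|apply: Ex_ge0 => w; exact: sqr_ge0].
rewrite [leRHS](_ : _ = j.+1%:R * 2 ^+ j * s2 + j.+1%:R * 2 ^+ j * s2 +
  2 * (2 ^+ j * s2)); last by ring.
by rewrite lerD ?lerD//; lra.
Qed.

(** By [ae_cvg0], the dyadic energy of depth [j] is eventually at most
    2^j (j + 1)^3, a factor of order (j + 1)^2 above its mean. *)
Lemma ae_max_increment : {ae P, forall w, \forall j \near \oo,
  forall i, (i <= 2 ^ j)%N -> increment 0 i w ^+ 2 <= j.+1%:R ^+ 4 * 2 ^+ j}.
Proof.
pose c j : R := (2 ^+ j * j.+1%:R ^+ 3)^-1.
have c0 j : 0 < c j by rewrite invr_gt0 mulr_gt0 ?exprn_gt0.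
pose s2 := Ex P (fun w => f (X 0%N w) ^+ 2).
have s20 : 0 <= s2 by apply: Ex_ge0 => w; exact: sqr_ge0.
have : {ae P, forall w, c j * dyadic_energy j 0 w @[j --> \oo] --> (0 : R)}.
  apply: (@ae_cvg0 _ _ _ P (fun j w => c j * dyadic_energy j 0 w) (s2 * 4)).
- by move=> j; apply: integrableRZ; case: (Ex_dyadic_energy j 0).
- by move=> j w; rewrite mulr_ge0 ?dyadic_energy_ge0// ltW.
- move=> n; apply: le_trans (ler_wpM2l s20 (sum_inv_sqrt3_le R n)).
  rewrite mulr_sumr; apply: ler_sum => j _.
  have [i1 e1] := Ex_dyadic_energy j 0.
  rewrite ExZ//; apply: (le_trans (ler_wpM2l (ltW (c0 j)) e1)).
  rewrite -/s2 /c.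
  have J0 : (0 : R) < j.+1%:R by rewrite ltr0n.
  rewrite [leLHS](_ : _ = s2 * (j.+1%:R ^+ 2)^-1); last first.
    by field; rewrite !gt_eqF ?exprn_gt0.
  rewrite ler_wpM2l// lef_pV2 ?posrE ?exprn_gt0 ?sqrtr_gt0//.
  set y := Num.sqrt _.
  have y1 : 1 <= y by rewrite -sqrtr1 ler_sqrt// ler1n.
  rewrite -(@sqr_sqrtr _ j.+1%:R)// -/y -exprM ler_weXn2l//.
apply: filterS => w Zw.
have Zn : \forall j \near \oo, c j * dyadic_energy j 0 w < 1.
  by apply: (cvgr_lt 0 Zw); exact: ltr01.
near=> j => i ij.
have Zj : c j * dyadic_energy j 0 w < 1 by near: j.
apply: (le_trans (increment_le_dyadic 0 w ij)).
have J0 : (0 : R) < j.+1%:R by rewrite ltr0n.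
rewrite -[leRHS](_ : j.+1%:R * (c j)^-1 = _); last by rewrite /c invrK; ring.
rewrite ler_pM2l//.
have := ltW Zj; by rewrite mulrC -ler_pdivlMr// div1r.
Unshelve. all: by end_near. Qed.


End maximal.

(** * Decay of a planar characteristic function *)

Section trigonometric_bounds.
Context (R : realType).
Implicit Types x y : R.

Lemma le_of_derive_ge0 (f df : R -> R) x :
  (forall y, is_derive y 1 f (df y)) -> (forall y, 0 < y -> 0 <= df y) ->
  0 <= x -> f 0 <= f x.
Proof.
move=> fdf df0 x0.
apply: (@ger0_derive1_ndecry R f 0) => //.
- by move=> y; rewrite in_itv/= andbT => y0; rewrite derive1E derive_val; exact: df0.
- apply: derivable_within_continuous => y _; exact: ex_derive.
Qed.

Lemma sin_le_id x : 0 <= x -> sin x <= x.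
Proof.
move=> x0.
have := @le_of_derive_ge0 (fun y => y - sin y) (fun y => 1 - cos y) x.
rewrite sin0 subr0 subr_ge0; exact.
Qed.

Lemma cosE_half x : cos x = 1 - 2 * sin (x / 2) ^+ 2.
Proof.
have {1}-> : x = (x / 2) *+ 2 by rewrite -mulr_natr; field.
by rewrite cos_mulr2n cos2sin2; ring.
Qed.

Lemma norm_sin_le x : `|sin x| <= `|x|.
Proof.
wlog x0 : x / 0 <= x.
  move=> H; have [/H//|/ltW x0] := leP 0 x.
  by rewrite -normrN -sinN -[ `|x| ]normrN H// oppr_ge0.
rewrite [ `|x| ]ger0_norm// ler_norml sin_le_id// andbT.
have [x1|x1] := leP 1 x; first by apply: le_trans (sin_geN1 x); rewrite lerN2.
suff : 0 <= sin x by lra.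
have [->|xn0] := eqVneq x 0; first by rewrite sin0.
by apply/ltW/sin2_gt0; rewrite lt_neqAle eq_sym xn0 x0/=; lra.
Qed.

Lemma sqr_sin_le x : sin x ^+ 2 <= x ^+ 2.
Proof.
rewrite -(real_normK (num_real (sin x))) -(real_normK (num_real x)).
by rewrite ler_pXn2r ?nnegrE// norm_sin_le.
Qed.

Lemma cos_ge x : 1 - x ^+ 2 / 2 <= cos x.
Proof. by rewrite cosE_half; have := sqr_sin_le (x / 2); nra. Qed.

Lemma sin_ge x : 0 <= x -> x - x ^+ 2 <= sin x.
Proof.
move=> x0.
have := @le_of_derive_ge0 (fun y => sin y - y + y * y) (fun y => cos y - 1 + 2 * y) x.
rewrite sin0 mul0r subr0 addr0 -expr2 => H.
suff : 0 <= sin x - x + x ^+ 2 by lra.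
apply: H => //.
- move=> y; apply: is_derive_eq.
  by rewrite /GRing.scale/= mulr1; ring.
- move=> y y0; rewrite cosE_half.
  have := norm_sin_le (y / 2); rewrite (ger0_norm (ltW (divr_gt0 y0 _)))// => h1.
  have := sin_max (y / 2) => h2.
  rewrite -(real_normK (num_real (sin _))).
  have := normr_ge0 (sin (y / 2)); nra.
Qed.

(** The cubic bound is replaced by a quadratic one, which holds for all [x]:
    second moments then suffice. *)
Lemma norm_sin_sub x : `|sin x - x| <= x ^+ 2.
Proof.
wlog x0 : x / 0 <= x.
  move=> H; have [/H//|/ltW x0] := leP 0 x.
  have := H (- x); rewrite sinN opprK -normrN opprD !opprK addrC sqrrN oppr_ge0 => /(_ x0).
  by rewrite addrC -normrN opprD opprK addrC.
by rewrite ler_norml; have := sin_ge x0; have := sin_le_id x0;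
  have := sqr_ge0 x; move=> *; apply/andP; split; lra.
Qed.

Lemma cos_le x : `|x| <= 1 -> cos x <= 1 - x ^+ 2 / 8.
Proof.
move=> x1.
have -> : cos x = cos `|x| by rewrite cos_norm.
rewrite -(real_normK (num_real x)); set y := `|x| in x1 *.
have y0 : 0 <= y by exact: normr_ge0.
rewrite cosE_half.
have y20 : 0 <= y / 2 by lra.
have h := sin_ge y20.
have h' : y / 4 <= sin (y / 2) by nra.
have : (y / 4) ^+ 2 <= sin (y / 2) ^+ 2 by rewrite ler_pXn2r ?nnegrE//; lra.
nra.
Qed.

End trigonometric_bounds.

Section characteristic_decay.
Context (R : realType) (disp : measure_display) (T : measurableType disp).
Variable P : probability T R.
Variables A B : T -> R.
Hypotheses (mA : measurable_fun setT A) (mB : measurable_fun setT B).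
Hypothesis iA : integrableR P (fun w => A w ^+ 2).
Hypothesis iB : integrableR P (fun w => B w ^+ 2).
Hypotheses (A0 : Ex P A = 0) (B0 : Ex P B = 0).

Let Q w := A w ^+ 2 + B w ^+ 2.
Let iQ : integrableR P Q. Proof. exact: integrableRD. Qed.
Let mQ : measurable_fun setT Q. Proof. exact: integrableR_measurable iQ. Qed.
Let Q0 w : 0 <= Q w. Proof. by rewrite addr_ge0// sqr_ge0. Qed.

(** Truncation that is uniform in the direction of the frequency. *)
Lemma tail_second_moment (e : R) : 0 < e ->
  exists2 n : nat, (0 < n)%N &
    Ex P (fun w => Q w * \1_[set w | n%:R < Q w] w) <= e.
Proof.
move=> e0.
have mS n : measurable [set w | n%:R < Q w].
  have -> : [set w | n%:R < Q w] = ~` [set w | Q w <= n%:R].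
    by apply/seteqP; split => w /=; rewrite real_ltNge ?num_real// => /negP.
  by apply: measurableC; exact: measurable_le_set.
have : Ex P (fun w => Q w * \1_[set w | n%:R < Q w] w) @[n --> \oo] -->
    Ex P (fun=> 0 : R).
  apply: (@Ex_cvg _ _ _ _ _ _ Q) => //.
  - by move=> n; apply: measurable_funM => //; exact: measurable_indic.
  - move=> n w; rewrite normrM -[leRHS]mulr1 (ger0_norm (Q0 w)).
    by rewrite ler_wpM2l// indic_norm_le1.
  - move=> w; apply: cvg_near_cst; near=> n.
    rewrite indicE memNset ?mulr0//= => /lt_geF.
    suff -> : Q w <= n%:R by [].
    by near: n; exact: nbhs_infty_ger.
rewrite Ex_cst => /(cvgr_lt 0) /(_ e e0) En.
near \oo => n; exists n; first by near: n; exact: nbhs_infty_gt.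
by apply/ltW; near: n.
Unshelve. all: by end_near. Qed.

(** The variance of [a * A + b * B]. *)
Definition quadratic_form (a b : R) :=
  a ^+ 2 * Ex P (fun w => A w ^+ 2) + 2 * a * b * Ex P (fun w => A w * B w) +
  b ^+ 2 * Ex P (fun w => B w ^+ 2).

Let iAB : integrableR P (fun w => A w * B w).
Proof. exact: integrableR_mul. Qed.

Lemma Ex_linear_sqr a b :
  integrableR P (fun w => (a * A w + b * B w) ^+ 2) /\
  Ex P (fun w => (a * A w + b * B w) ^+ 2) = quadratic_form a b.
Proof.
have -> : (fun w => (a * A w + b * B w) ^+ 2) = (fun w =>
    a ^+ 2 * A w ^+ 2 + 2 * a * b * (A w * B w) + b ^+ 2 * B w ^+ 2).
  by apply/funext => w; ring.
have i1 : integrableR P (fun w => a ^+ 2 * A w ^+ 2 + 2 * a * b * (A w * B w)).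
  by apply: integrableRD; exact: integrableRZ.
split; first by apply: integrableRD => //; exact: integrableRZ.
by rewrite !ExD ?ExZ//; exact: integrableRZ.
Qed.

Hypothesis pos : 0 < Ex P (fun w => A w ^+ 2).
Hypothesis det_pos : Ex P (fun w => A w * B w) ^+ 2 <
  Ex P (fun w => A w ^+ 2) * Ex P (fun w => B w ^+ 2).

(** Determinant over trace is a lower bound for the smallest eigenvalue; the
    difference of the two sides is an explicit sum of squares. *)
Lemma quadratic_form_ge :
  exists2 l : R, 0 < l & forall a b, l * (a ^+ 2 + b ^+ 2) <= quadratic_form a b.
Proof.
rewrite /quadratic_form; move: pos det_pos.
set p := Ex P (fun w => A w ^+ 2); set q := Ex P (fun w => B w ^+ 2).
set r := Ex P _ => p0 rpq.
have q0 : 0 <= q by apply: Ex_ge0 => w; exact: sqr_ge0.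
have t0 : 0 < p + q by lra.
exists ((p * q - r ^+ 2) / (p + q)); first by rewrite divr_gt0// subr_gt0.
move=> a b; rewrite -subr_ge0.
rewrite [X in 0 <= X](_ : _ = ((p * a + r * b) ^+ 2 + (r * a + q * b) ^+ 2) / (p + q)).
  by rewrite divr_ge0 ?addr_ge0 ?sqr_ge0// ltW.
by field; rewrite gt_eqF.
Qed.

(** Write Y for the linear combination and t = a^2 + b^2.  On the event where
    the truncated vector makes |Y| <= 1, 1 - cos Y is at least Y^2 / 8, so the
    real part falls below 1 by a multiple of t.  The imaginary part is the mean
    of sin Y - Y, of order t, so its square is negligible. *)
Lemma characteristic_decay : exists c de : R, [/\ 0 < c, 0 < de &
  forall a b, a ^+ 2 + b ^+ 2 <= de ->
    Ex P (fun w => cos (a * A w + b * B w)) ^+ 2 +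
    Ex P (fun w => sin (a * A w + b * B w)) ^+ 2 <=
    expR (- (c * (a ^+ 2 + b ^+ 2)))].
Proof.
have [l l0 Hl] := quadratic_form_ge.
have [n n0 Hn] := @tail_second_moment (l / 2) (divr_gt0 l0 (ltr0n _ 2)).
set s := Ex P Q.
have s0 : 0 <= s by exact: Ex_ge0.
have n1 : (1 : R) <= n%:R by rewrite ler1n.
pose K := n%:R + s + 32 * s ^+ 2 / l.
have K1 : 0 <= 32 * s ^+ 2 / l by rewrite divr_ge0 ?mulr_ge0 ?sqr_ge0// ltW.
have K0 : 0 < K by rewrite /K; lra.
exists (l / 32), K^-1; split; [lra|by rewrite invr_gt0|].
move=> a b; set t := a ^+ 2 + b ^+ 2 => td.
have t0 : 0 <= t by rewrite addr_ge0// sqr_ge0.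
(* The three summands of K make, in turn: the phase at most 1 on the
   truncation event, the cosine part nonnegative, and the square of the sine
   part at most half of the gain from the cosine part. *)
have tK : t * K <= 1 by rewrite -ler_pdivlMr// div1r.
have tn : t * n%:R <= 1 by apply: le_trans tK; rewrite ler_wpM2l// /K; lra.
have ts : t * s <= 1 by apply: le_trans tK; rewrite ler_wpM2l// /K; lra.
have ts2 : t * s ^+ 2 <= l / 32.
  have : t * (32 * s ^+ 2 / l) <= 1 by apply: le_trans tK; rewrite ler_wpM2l// /K; lra.
  by rewrite mulrA ler_pdivrMr//; lra.
pose Y w := a * A w + b * B w.
have mY : measurable_fun setT Y.
  by apply: measurable_funD; apply: measurable_funM.
have [iY2 EY2] := Ex_linear_sqr a b.
have YQ w : Y w ^+ 2 <= t * Q w.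
  rewrite -subr_ge0 [X in 0 <= X](_ : _ = (a * B w - b * A w) ^+ 2) ?sqr_ge0//.
  by rewrite /t /Q /Y; ring.
have [mc ms] := measurable_cos_sin mY.
have ic : integrableR P (fun w => cos (Y w)).
  by apply: (@integrableR_bounded _ _ _ _ _ 1) => // w; exact: cos_max.
have isn : integrableR P (fun w => sin (Y w)).
  by apply: (@integrableR_bounded _ _ _ _ _ 1) => // w; exact: sin_max.
set C := Ex P (fun w => cos _); set S := Ex P (fun w => sin _).
have C1 : C <= 1.
  rewrite -(Ex_cst P 1); apply: le_Ex => //; exact: integrableR_cst.
have EY2s : Ex P (fun w => Y w ^+ 2) <= t * s.
  by rewrite -ExZ//; apply: le_Ex => //; exact: integrableRZ.
have C0 : 0 <= C.
  have i1 : integrableR P (fun w => 2^-1 * Y w ^+ 2) by exact: integrableRZ.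
  have : Ex P (fun w => 1 - 2^-1 * Y w ^+ 2) <= C.
    apply: le_Ex => //; first by apply: integrableRB => //; exact: integrableR_cst.
    by move=> w; have := cos_ge (Y w); rewrite /Y; lra.
  rewrite ExB ?Ex_cst ?ExZ//; last exact: integrableR_cst.
  lra.
have iT : integrableR P (fun w => Q w * \1_[set w | n%:R < Q w] w).
  apply: (@integrableR_le _ _ _ _ _ Q) => //.
    apply: measurable_funM => //; apply: measurable_indic.
    have -> : [set w | n%:R < Q w] = ~` [set w | Q w <= n%:R].
      by apply/seteqP; split => w /=; rewrite real_ltNge ?num_real// => /negP.
    by apply: measurableC; exact: measurable_le_set.
  move=> w; rewrite normrM -[leRHS]mulr1 (ger0_norm (Q0 w)).
  by rewrite ler_wpM2l// indic_norm_le1.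
have C2 : C <= 1 - l / 16 * t.
  have i1 : integrableR P (fun w => 8^-1 * (Y w ^+ 2 - t * (Q w * \1_[set w | n%:R < Q w] w))).
    by apply: integrableRZ; apply: integrableRB => //; exact: integrableRZ.
  have : C <= Ex P (fun w => 1 - 8^-1 * (Y w ^+ 2 - t * (Q w * \1_[set w | n%:R < Q w] w))).
    apply: le_Ex => //; first by apply: integrableRB => //; exact: integrableR_cst.
    move=> w; rewrite -/(Y w) indicE.
    have [nQ|Qn] := ltP n%:R (Q w).
      by rewrite mem_set//= mulr1; have := YQ w; have := cos_le1 (Y w); lra.
    rewrite memNset/=; last by move=> /lt_geF; rewrite Qn.
    have Y1 : `|Y w| <= 1.
      rewrite -(@ler_pXn2r _ 2)// ?nnegrE// real_normK ?num_real// expr1n.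
      by apply: (le_trans (YQ w)); apply: le_trans tn; rewrite ler_wpM2l.
    by have := cos_le Y1; lra.
  rewrite ExB ?Ex_cst//; last exact: integrableR_cst.
  rewrite ExZ; last by apply: integrableRB => //; exact: integrableRZ.
  rewrite ExB//; last exact: integrableRZ.
  rewrite ExZ// EY2; have := Hl a b; rewrite -/t.
  have := ler_wpM2l t0 Hn; lra.
have iA1 : integrableR P A by exact: integrableR_of_sqr.
have iB1 : integrableR P B by exact: integrableR_of_sqr.
have iY : integrableR P Y by apply: integrableRD; exact: integrableRZ.
have EY : Ex P Y = 0.
  by rewrite /Y ExD ?ExZ// ?A0 ?B0 ?mulr0 ?addr0//; exact: integrableRZ.
have S1 : `|S| <= t * s.
  apply: le_trans EY2s.
  have -> : S = Ex P (fun w => sin (Y w) - Y w) by rewrite ExB// EY subr0.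
  have iD : integrableR P (fun w => sin (Y w) - Y w) by exact: integrableRB.
  apply: (le_trans (Ex_norm iD)); apply: le_Ex => //.
    exact: integrable_norm iD.
  by move=> w; exact: norm_sin_sub.
have S2 : S ^+ 2 <= t * (l / 32).
  rewrite -(real_normK (num_real S)).
  apply: (@le_trans _ _ ((t * s) ^+ 2)); first by rewrite ler_pXn2r ?nnegrE// mulr_ge0.
  by rewrite exprMn expr2 -mulrA ler_wpM2l.
apply: le_trans (expR_ge1Dx _).
have : C ^+ 2 <= C by rewrite expr2 ler_piMr.
lra.
Qed.

End characteristic_decay.

(** * Small-ball probabilities of the centre of mass *)

Section discrete_fejer.
Context (R : realType) (disp : measure_display) (T : measurableType disp).
Variable P : probability T R.
Variables Y0 Y1 : T -> R.
Hypotheses (mY0 : measurable_fun setT Y0) (mY1 : measurable_fun setT Y1).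

(** Discrete Esseen inequality.  The squared modulus of the sum of the characters
    at the N^2 grid frequencies h (i, j) is nonnegative, and is at least
    N^4 / 4 where all phases are at most 1.  Its mean is a sum of values of the
    characteristic function at differences of grid points, which [F] bounds. *)
Lemma small_square_prob (N : nat) (h x K : R) (F : nat -> nat -> R) :
  (0 < N)%N -> 0 <= h -> 2 * h * N%:R * x <= 1 ->
  (forall i k, 0 <= F i k) ->
  (forall i, (i < N)%N -> \sum_(k < N) F i k <= K) ->
  (forall i j k l, (i < N)%N -> (j < N)%N -> (k < N)%N -> (l < N)%N ->
    Ex P (fun w => cos (h * (i%:R - k%:R) * Y0 w + h * (j%:R - l%:R) * Y1 w)) <=
    F i k * F j l) ->
  fine (P [set w | `|Y0 w| <= x /\ `|Y1 w| <= x]) <= 4 * K ^+ 2 / N%:R ^+ 2.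
Proof.
move=> N0 h0 hNx F0 FK charF.
pose th (m : 'I_N * 'I_N) w := h * (m.1%:R * Y0 w + m.2%:R * Y1 w).
pose Z w := (\sum_m cos (th m w)) ^+ 2 + (\sum_m sin (th m w)) ^+ 2.
have ZE w : Z w = \sum_m \sum_m' cos (th m w - th m' w).
  rewrite /Z !expr2 !big_distrlr -big_split; apply: eq_bigr => m _ /=.
  by rewrite -big_split; apply: eq_bigr => m' _; rewrite cosB.
have mth m : measurable_fun setT (th m).
  by apply: measurable_funM => //; apply: measurable_funD; apply: measurable_funM.
have icos m m' : integrableR P (fun w => cos (th m w - th m' w)).
  apply: (@integrableR_bounded _ _ _ _ _ 1) => [|w]; last exact: cos_max.
  by have [] := measurable_cos_sin (measurable_funB (mth m) (mth m')).
have isum m : integrableR P (fun w => \sum_m' cos (th m w - th m' w)).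
  exact: integrableR_sum.
have iZ : integrableR P Z by rewrite (funext ZE); exact: integrableR_sum.
have NR : (0 : R) < N%:R by rewrite ltr0n.
have EZ : Ex P Z <= N%:R ^+ 2 * K ^+ 2.
  rewrite (funext ZE) Ex_sum//.
  apply: (@le_trans _ _ (\sum_(m : 'I_N * 'I_N) K ^+ 2)); last first.
    by rewrite sumr_const card_prod card_ord -[leLHS]mulr_natl natrM -expr2.
  apply: ler_sum => m _; rewrite Ex_sum//.
  apply: (@le_trans _ _ (\sum_(m' : 'I_N * 'I_N) F m.1 m'.1 * F m.2 m'.2)).
    apply: ler_sum => m' _.
    have -> : (fun w => cos (th m w - th m' w)) = (fun w =>
       cos (h * (m.1%:R - m'.1%:R) * Y0 w + h * (m.2%:R - m'.2%:R) * Y1 w)).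
      by apply/funext => w; congr cos; rewrite /th; ring.
    exact: charF.
  rewrite -(pair_big xpredT xpredT (fun k l : 'I_N => F m.1 k * F m.2 l))/=.
  rewrite -big_distrlr/= expr2.
  by apply: ler_pM; rewrite ?sumr_ge0// FK.
have mA : measurable [set w | `|Y0 w| <= x /\ `|Y1 w| <= x].
  have -> : [set w | `|Y0 w| <= x /\ `|Y1 w| <= x] =
     [set w | `|Y0 w| <= x] `&` [set w | `|Y1 w| <= x] by [].
  by apply: measurableI; apply: measurable_le_set => //; exact: measurableT_comp.
have := @prob_le_Ex _ _ _ P _ Z ((N%:R ^+ 2 / 2) ^+ 2) mA iZ.
move=> H; have {}H : fine (P [set w | `|Y0 w| <= x /\ `|Y1 w| <= x]) *
    (N%:R ^+ 2 / 2) ^+ 2 <= N%:R ^+ 2 * K ^+ 2.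
  apply: le_trans EZ; apply: H => w; first by rewrite addr_ge0// sqr_ge0.
  move=> /= [Y0x Y1x].
  have x0 : 0 <= x by apply: le_trans Y0x.
  suff H : N%:R ^+ 2 / 2 <= \sum_m cos (th m w).
    apply: (@le_trans _ _ ((\sum_m cos (th m w)) ^+ 2)); last by rewrite lerDl sqr_ge0.
    have H0 : 0 <= (N%:R ^+ 2 / 2 : R) by rewrite divr_ge0.
    by rewrite ler_pXn2r ?nnegrE ?H0 ?(le_trans H0 H).
  have -> : N%:R ^+ 2 / 2 = \sum_(m : 'I_N * 'I_N) (2^-1 : R).
    by rewrite sumr_const card_prod card_ord -[RHS]mulr_natl natrM -expr2.
  apply: ler_sum => m _.
  suff th1 : th m w ^+ 2 <= 1 by have := cos_ge (th m w); lra.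
  rewrite -(real_normK (num_real (th m w))) exprn_ile1//.
  apply: le_trans hNx; rewrite /th normrM (ger0_norm h0).
  rewrite [leRHS](_ : _ = h * (N%:R * x + N%:R * x)); last by ring.
  rewrite ler_wpM2l// (le_trans (ler_normD _ _))// lerD// normrM ger0_norm//.
    by rewrite ler_pM// ler_nat ltnW.
  by rewrite ler_pM// ler_nat ltnW.
rewrite ler_pdivlMr ?exprn_gt0// -(@ler_pM2r _ (N%:R ^+ 2 / 4)) ?divr_gt0 ?exprn_gt0//.
lra.
Qed.

End discrete_fejer.

(** As subtraction is truncated, the exponent is the distance between i and k;
    each side of i contributes at most 1 / (1 - r). *)
Lemma sum_geometric_dist_le (R : realType) (r : R) (N i : nat) : 0 <= r -> r < 1 ->
  (i < N)%N -> \sum_(k < N) r ^+ ((i - k) + (k - i)) <= 2 / (1 - r).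
Proof.
move=> r0 r1 iN.
have r1' : 0 < 1 - r by lra.
have below M : (M <= i.+1)%N ->
    \sum_(k < M) r ^+ ((i - k) + (k - i)) <= r ^+ (i.+1 - M) / (1 - r).
  elim: M => [|M IH] Mi; first by rewrite big_ord0 divr_ge0 ?exprn_ge0// ltW.
  rewrite big_ord_recr /=; apply: (le_trans (lerD (IH (ltnW Mi)) (lexx _))).
  have -> : (i - M + (M - i) = i - M)%N by lia.
  rewrite subSS subSn// exprS.
  rewrite le_eqVlt; apply/orP; left; apply/eqP; field; lra.
have above m : \sum_(k < i.+1 + m) r ^+ ((i - k) + (k - i)) <=
    2 / (1 - r) - r ^+ m.+1 / (1 - r).
  elim: m => [|m IH].
    rewrite addn0; apply: (le_trans (below _ (leqnn _))).
    rewrite subnn expr0 -mulrBl ler_pM2r ?invr_gt0// expr1; lra.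
  rewrite addnS big_ord_recr /=; apply: (le_trans (lerD IH (lexx _))).
  have -> : (i - (i.+1 + m) + (i.+1 + m - i) = m.+1)%N by lia.
  rewrite (exprS _ m.+1) le_eqVlt; apply/orP; left; apply/eqP; field; lra.
rewrite -(subnKC iN); apply: (le_trans (above _)).
by rewrite gerBl divr_ge0 ?exprn_ge0// ltW.
Qed.

Lemma sqr_natB (R : realType) (p q : nat) :
  ((p%:R - q%:R) ^+ 2 : R) = ((p - q) + (q - p))%:R ^+ 2.
Proof.
have [pq|/ltnW pq] := leqP p q.
  rewrite (_ : (p - q = 0)%N) ?add0n ?natrB//; first by ring.
  by apply/eqP; rewrite subn_eq0.
rewrite (_ : (q - p = 0)%N) ?addn0 ?natrB//.
by apply/eqP; rewrite subn_eq0.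
Qed.

Lemma sqr_natB_le (R : realType) (N p q : nat) : (p < N)%N -> (q < N)%N ->
  ((p%:R - q%:R) ^+ 2 : R) <= N%:R ^+ 2.
Proof.
move=> pN qN; rewrite sqr_natB ler_pXn2r ?nnegrE// ler_nat.
by move: pN qN; clear; lia.
Qed.

Section centre_of_mass.
Context (R : realType) (disp : measure_display) (T : measurableType disp).
Variable P : probability T R.
Variable d : nat.
Local Notation V := (g_sigma_algebraType (@open 'cV[R]_d)).
Variable X : nat -> T -> 'cV[R]_d.

Lemma walkE n w : walk X n w = \sum_(j < n) X j.+1 w.
Proof. by rewrite /walk big_add1 big_mkord. Qed.

(** Step j is counted in S_j, ..., S_n. *)
Lemma centre_of_massE n w : centre_of_mass X n w =
  n%:R^-1 *: \sum_(j < n) (n - j)%:R *: X j.+1 w.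
Proof.
rewrite /centre_of_mass; congr (_ *: _); rewrite big_add1 big_mkord.
elim: n => [|n IH]; first by rewrite !big_ord0.
rewrite big_ord_recr /= IH walkE [RHS]big_ord_recr [in LHS]big_ord_recr/=.
rewrite addrA -big_split/= subSnn scale1r; congr (_ + _).
apply: eq_bigr => j _; rewrite -[X j.+1 w as X in _ + X]scale1r -scalerDl.
by rewrite natr1 subSn// ltnW.
Qed.

Hypothesis hX : iid_random_vectors P X.
Variables (i0 i1 : 'I_d) (c de : R).
Hypotheses (c0 : 0 < c) (de0 : 0 < de).
Hypothesis decay : forall a b : R, a ^+ 2 + b ^+ 2 <= de ->
    Ex P (fun w => cos (a * X 0%N w i0 0 + b * X 0%N w i1 0)) ^+ 2 +
    Ex P (fun w => sin (a * X 0%N w i0 0 + b * X 0%N w i1 0)) ^+ 2 <=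
    expR (- (c * (a ^+ 2 + b ^+ 2))).

Lemma sum_squares_ge n : n%:R ^+ 3 / 3 <= \sum_(j < n) ((n - j)%:R : R) ^+ 2.
Proof.
rewrite (reindex_inj rev_ord_inj)/=.
rewrite (eq_bigr (fun j : 'I_n => (j.+1%:R : R) ^+ 2)); last first.
  by move=> j _; congr (_%:R ^+ 2); have := ltn_ord j; lia.
elim: n => [|n IH]; first by rewrite big_ord0 expr0n/= mul0r.
rewrite big_ord_recr/= -natr1; apply: le_trans (lerD IH (lexx _)).
have := ler0n R n; nra.
Qed.

Lemma measurable_step_coord n i : measurable_fun setT (fun w => X n w i 0).
Proof.
pose f (x : V) : R := (x : 'cV[R]_d) i 0.
have mf : measurable_fun setT f by exact: measurable_coord.
exact: (measurableT_comp mf (measurable_step hX n)).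
Qed.

Lemma measurable_centre_coord n i :
  measurable_fun setT (fun w => centre_of_mass X n w i 0).
Proof.
under eq_fun do rewrite centre_of_massE mxE summxE.
apply: measurable_funM => //; apply: measurable_sum => j.
under eq_fun do rewrite mxE; apply: measurable_funM => //.
exact: measurable_step_coord.
Qed.

(** The decay applies to each factor since the weights (n - j) / n are at most
    one, and the squares of these weights add up to at least n / 3. *)
Lemma charf_centre_of_mass n a b : (0 < n)%N -> a ^+ 2 + b ^+ 2 <= de ->
  Ex P (fun w => cos (a * centre_of_mass X n w i0 0 + b * centre_of_mass X n w i1 0)) ^+ 2
  <= expR (- (c / 3 * n%:R * (a ^+ 2 + b ^+ 2))).
Proof.
move=> n0 abde.
have NR : (0 : R) < n%:R by rewrite ltr0n.
pose r j : R := (n - j)%:R / n%:R.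
pose g j (x : V) := r j * a * (x : 'cV[R]_d) i0 0 + r j * b * (x : 'cV[R]_d) i1 0.
have mg j : measurable_fun setT (g j).
  by apply: measurable_funD; apply: measurable_funM => //; exact: measurable_coord.
have -> : (fun w => cos (a * centre_of_mass X n w i0 0 + b * centre_of_mass X n w i1 0)) =
    (fun w => cos (phase X g n w)).
  apply/funext => w; congr cos; rewrite centre_of_massE /phase !mxE !summxE.
  rewrite !mulr_sumr -big_split/=; apply: eq_bigr => j _.
  by rewrite /g /r !mxE; ring.
apply: (le_trans (Ex_cos_phase_le hX mg n)).
apply: (@le_trans _ _ (\prod_(j < n) expR (- (c * (r j ^+ 2 * (a ^+ 2 + b ^+ 2)))))).
  apply: ler_prod => j _; rewrite addr_ge0 ?sqr_ge0//=.
  rewrite mulrDr -!exprMn; apply: decay; rewrite !exprMn -mulrDr.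
  have rj0 : 0 <= r j by rewrite /r divr_ge0.
  have rj1 : r j <= 1 by rewrite /r ler_pdivrMr// mul1r ler_nat leq_subr.
  apply: le_trans abde; apply: ler_piMl; first by rewrite addr_ge0// sqr_ge0.
  by rewrite -exprMn; exact: exprn_ile1.
rewrite -expR_sum ler_expR sumrN lerN2.
rewrite -mulr_sumr -mulr_suml -mulrA -mulrA ler_wpM2l ?(ltW c0)// mulrA.
rewrite ler_wpM2r ?addr_ge0 ?sqr_ge0//.
rewrite /r; under eq_bigr do rewrite exprMn.
rewrite -mulr_suml exprVn ler_pdivlMr ?exprn_gt0//.
by apply: le_trans (sum_squares_ge n); rewrite le_eqVlt; apply/orP; left; apply/eqP; ring.
Qed.

(** [small_square_prob] with grid step 1 / sqrt n and N of order 1 / x, unless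
    this exceeds the range sqrt n where the decay is known; then N of order
    sqrt n gives the term 1 / n.  When N would vanish, the bound exceeds 1. *)
Lemma small_centre_of_mass_prob : exists2 C : R, 0 < C &
  forall (n : nat) (x : R), (0 < n)%N -> 0 < x ->
  fine (P [set w | `|centre_of_mass X n w i0 0| <= Num.sqrt n%:R * x /\
                   `|centre_of_mass X n w i1 0| <= Num.sqrt n%:R * x])
  <= C * (x ^+ 2 + n%:R^-1).
Proof.
(* The modulus at grid differences (p, q) is exp(- c (p^2 + q^2) / 6), and
   p^2 >= p reduces it to a geometric law in each coordinate. *)
pose r := expR (- (c / 6)).
have r0 : 0 <= r by exact: expR_ge0.
have r1 : r < 1 by rewrite expR_lt1 oppr_lt0 divr_gt0.
pose K := 2 / (1 - r).
have K0 : 0 <= K by rewrite divr_ge0//; lra.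
have mG := measurable_centre_coord.
exists (4 + 2 / de + 16 * K ^+ 2 * (4 + 2 / de)).
  have d0 : 0 < 2 / de by rewrite divr_gt0.
  have : 0 <= 16 * K ^+ 2 * (4 + 2 / de).
    by apply: mulr_ge0; [apply: mulr_ge0 => //; exact: sqr_ge0|lra].
  lra.
move=> n x n0 x0.
have NR : (0 : R) < n%:R by rewrite ltr0n.
have de2 : 0 < 2 / de by rewrite divr_gt0.
have nV : 0 < (n%:R : R)^-1 by rewrite invr_gt0.
have x2 : 0 < x ^+ 2 by rewrite exprn_gt0.
set A := [set w | _ /\ _].
have PA1 : fine (P A) <= 1.
  have mA : measurable A.
    have -> : A = [set w | `|centre_of_mass X n w i0 0| <= Num.sqrt n%:R * x] `&`
       [set w | `|centre_of_mass X n w i1 0| <= Num.sqrt n%:R * x] by [].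
    by apply: measurableI; apply: measurable_le_set => //; exact: measurableT_comp.
  by rewrite -lee_fin fineK ?fin_num_measure//; exact: probability_le1.
pose y := Num.min (2 * x)^-1 (Num.sqrt (de * n%:R / 2)).
have y2 : y ^- 2 <= 4 * x ^+ 2 + 2 / de * n%:R^-1.
  rewrite /y /Num.min; case: ifP => _.
    rewrite exprVn invrK exprMn; have : 0 <= 2 / de * n%:R^-1 by rewrite mulr_ge0// ltW.
    lra.
  rewrite sqr_sqrtr; last by rewrite divr_ge0// mulr_ge0// ltW.
  rewrite (_ : (_ / 2)^-1 = 2 / de * n%:R^-1); first lra.
  by field; rewrite !gt_eqF.
have y0 : 0 < y.
  by rewrite /y lt_min invr_gt0 sqrtr_gt0 !mulr_gt0.
have yx : 2 * x * y <= 1.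
  by rewrite mulrC -ler_pdivlMr ?mulr_gt0// div1r /y ge_min lexx.
have yn : 2 * y ^+ 2 <= de * n%:R.
  have : y ^+ 2 <= Num.sqrt (de * n%:R / 2) ^+ 2.
    have ymin : y <= Num.sqrt (de * n%:R / 2) by rewrite /y ge_min lexx orbT.
    by rewrite ler_pXn2r// nnegrE ?sqrtr_ge0// ltW.
  rewrite sqr_sqrtr; last by rewrite divr_ge0// mulr_ge0// ltW.
  lra.
set D := 4 * x ^+ 2 + 2 / de * n%:R^-1 in y2.
have DC : D <= (4 + 2 / de) * (x ^+ 2 + n%:R^-1) by rewrite /D; nra.
suff H : fine (P A) <= D + 16 * K ^+ 2 * D.
  apply: (le_trans H).
  have : 16 * K ^+ 2 * D <= 16 * K ^+ 2 * ((4 + 2 / de) * (x ^+ 2 + n%:R^-1)).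
    by apply: ler_wpM2l => //; apply: mulr_ge0 => //; exact: sqr_ge0.
  lra.
have D0 : 0 <= D by apply: le_trans y2; rewrite invr_ge0 exprn_ge0// ltW.
have [y1|y1] := ltP y 1.
  have : 1 <= y ^- 2.
    by rewrite invf_ge1 ?exprn_gt0// exprn_ile1// ltW.
  have : 0 <= 16 * K ^+ 2 * D by apply: mulr_ge0 => //; apply: mulr_ge0 => //; exact: sqr_ge0.
  lra.
pose N := Num.truncn y.
have /andP[Ny yN] : N%:R <= y < N.+1%:R by rewrite truncn_itv// ltW.
have N0 : (0 < N)%N by rewrite /N truncn_gt0.
have NN : (0 : R) < N%:R by rewrite ltr0n.
have N1 : (1 : R) <= N%:R by rewrite ler1n.
have s0 : 0 < Num.sqrt n%:R :> R by rewrite sqrtr_gt0.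
have ss : Num.sqrt n%:R ^+ 2 = n%:R :> R by rewrite sqr_sqrtr// ltW.
have := @small_square_prob _ _ _ P _ _ (mG n i0) (mG n i1) N (Num.sqrt n%:R)^-1
  (Num.sqrt n%:R * x) K (fun i k => r ^+ ((i - k) + (k - i))) N0.
rewrite -/A => H.
have {}H : fine (P A) <= 4 * K ^+ 2 / N%:R ^+ 2.
  apply: H.
  - by rewrite invr_ge0 ltW.
  - rewrite [leLHS](_ : _ = 2 * x * N%:R); last by field; rewrite gt_eqF.
    by apply: le_trans yx; rewrite ler_wpM2l// mulr_ge0// ltW.
  - by move=> i k; exact: exprn_ge0.
  - by move=> i iN; exact: sum_geometric_dist_le.
  move=> i j k l iN jN kN lN.
  set a := _ * (i%:R - k%:R); set b := _ * (j%:R - l%:R).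
  have ab : a ^+ 2 + b ^+ 2 = ((i%:R - k%:R) ^+ 2 + (j%:R - l%:R) ^+ 2) / n%:R.
    by rewrite /a /b -[in RHS]ss; field; rewrite gt_eqF.
  have abde : a ^+ 2 + b ^+ 2 <= de.
    rewrite ab ler_pdivrMr//; apply: le_trans yn.
    have := sqr_natB_le R iN kN; have := sqr_natB_le R jN lN.
    have : (N%:R : R) ^+ 2 <= y ^+ 2 by rewrite ler_pXn2r ?nnegrE// ltW.
    lra.
  have := charf_centre_of_mass n0 abde; set E := Ex _ _ => HE.
  apply: (le_trans (ler_norm E)).
  rewrite -(@ler_pXn2r _ 2)// ?nnegrE ?mulr_ge0 ?exprn_ge0//.
  rewrite real_normK ?num_real//; apply: (le_trans HE).
  rewrite -exprD -exprM /r -expRM_natl ler_expR.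
  rewrite mulrN lerN2 ab !sqr_natB natrM natrD.
  set p := (_ + _)%N; set q := (_ + _)%N.
  rewrite (_ : c / 3 * _ * _ = c / 3 * (p%:R ^+ 2 + q%:R ^+ 2)); last first.
    by field; rewrite gt_eqF.
  have sq (m : nat) : 0 <= c * ((m%:R : R) ^+ 2 - m%:R).
    rewrite mulr_ge0 ?(ltW c0)// subr_ge0 -natrX ler_nat.
    by case: m => // m; rewrite leq_pmulr.
  have := sq p; have := sq q; lra.
apply: (le_trans H).
have Hy : N%:R ^- 2 <= 4 * y ^- 2.
  rewrite -[leRHS]invrK lef_pV2 ?posrE ?exprn_gt0// ?invr_gt0 ?mulr_gt0 ?invr_gt0 ?exprn_gt0//.
  rewrite invfM invrK; have : y <= 2 * N%:R by rewrite (le_trans (ltW yN))// -natr1; lra.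
  nra.
have : K ^+ 2 * N%:R ^- 2 <= K ^+ 2 * (4 * D).
  by rewrite ler_wpM2l ?sqr_ge0// (le_trans Hy)//; lra.
lra.
Qed.

End centre_of_mass.

(** * Averages between checkpoints *)

Section growth.
Context (R : realType).

Lemma powR_near_ge (K a : R) : 0 < a -> \forall n \near \oo, K <= n%:R `^ a.
Proof.
move=> a0; pose K' := Num.max K 1.
have K'0 : 0 < K' by rewrite lt_max ltr01 orbT.
near=> n.
apply: (@le_trans _ _ K'); first by rewrite le_max lexx.
have -> : K' = (K' `^ a^-1) `^ a by rewrite -powRrM mulVf ?gt_eqF// powRr1// ltW.
apply: ge0_ler_powR; rewrite ?nnegrE ?powR_ge0 ?ler0n//; first exact: ltW.
by near: n; exact: nbhs_infty_ger.
Unshelve. all: by end_near. Qed.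

Lemma ln_le_powR (x a : R) : 0 < x -> 0 < a -> ln x <= a^-1 * x `^ a.
Proof.
move=> x0 a0.
have xa : 0 < x `^ a by rewrite powR_gt0.
have : ln (x `^ a) <= x `^ a.
  have := @ln_sublinear R (x `^ a) xa; exact: ltW.
rewrite ln_powR => H.
by rewrite -(@ler_pM2l _ a)// mulrA mulfV ?gt_eqF// mul1r.
Qed.

(** Take the least [j] with n <= 2^j, so 2^j <= 2 n, and absorb the power of
    log n into n^a. *)
Lemma dyadic_bound_powR (s : nat -> R) (a : R) : 0 < a ->
  (\forall j \near \oo, forall m, (m <= 2 ^ j)%N -> s m ^+ 2 <= j.+1%:R ^+ 4 * 2 ^+ j) ->
  \forall n \near \oo, forall m, (m <= n)%N -> `|s m| <= n%:R `^ a * Num.sqrt n%:R.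
Proof.
move=> a0 [j0 _ Hj].
(* Bounding log n by a multiple of n^(a / 4) leaves n^a after the fourth
   power, against n^(2 a) on the right. *)
pose b := a / 4; have b0 : 0 < b by rewrite divr_gt0.
have l2 : 0 < ln (2 : R) by rewrite ln_gt0// ltr1n.
pose C := b^-1 / ln 2 + 2.
have C0 : 0 < C by rewrite ltr_wpDl// mulr_ge0// invr_ge0 ltW.
near=> n => m mn.
have n1 : (1 < n)%N by near: n; exact: nbhs_infty_gt.
have nR : (0 : R) < n%:R by rewrite ltr0n; exact: ltn_trans n1.
have nR1 : (1 : R) <= n%:R by rewrite ler1n; exact: ltnW.
pose j := up_log 2 n.
have /andP[jn nj] : (2 ^ j.-1 < n <= 2 ^ j)%N by exact: up_log_bounds.
have jj0 : (j0 <= j)%N.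
  have : (2 ^ j0 < n)%N by near: n; exact: nbhs_infty_gt.
  by move=> h; have := leq_trans h nj; rewrite ltn_exp2l// => /ltnW.
have jpos : (0 < j)%N.
  by rewrite lt0n; apply/eqP => j00; move: nj; rewrite j00 leqNgt n1.
have pow_j : (2 : R) ^+ j <= 2 * n%:R.
  rewrite -(prednK jpos) exprS ler_pM2l// -natrX ler_nat; exact: ltnW.
have jC : (j.+1%:R : R) <= C * n%:R `^ b.
  have nb1 : 1 <= n%:R `^ b by have := ler_powR nR1 (ltW b0); rewrite powRr0.
  have h1 : (j.-1%:R : R) * ln 2 <= ln n%:R.
    rewrite mulrC mulr_natr -lnXn// ler_ln ?posrE ?exprn_gt0// -natrX ler_nat.
    exact: ltnW.
  have h2 := ln_le_powR nR b0.
  have h3 : (j.-1%:R : R) <= (b^-1 / ln 2) * n%:R `^ b.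
    by rewrite mulrAC ler_pdivlMr//; exact: le_trans h1 h2.
  rewrite -(prednK jpos) -!natr1 /C; lra.
have s2 : s m ^+ 2 <= (n%:R `^ a * Num.sqrt n%:R) ^+ 2.
  apply: (le_trans (Hj j jj0 m (leq_trans mn nj))).
  rewrite exprMn sqr_sqrtr ?ler0n//.
  apply: (@le_trans _ _ ((C * n%:R `^ b) ^+ 4 * (2 * n%:R))).
    by rewrite ler_pM ?exprn_ge0// ler_pXn2r ?nnegrE ?mulr_ge0 ?powR_ge0// ltW.
  rewrite mulrA ler_pM2r// exprMn -[(_ `^ b) ^+ 4]powR_mulrn ?powR_ge0// -powRrM.
  rewrite (_ : b * 4%:R = a); last by rewrite /b; field.
  rewrite expr2 mulrAC ler_wpM2r ?powR_ge0//.
  by near: n; exact: powR_near_ge.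
rewrite -(@ler_pXn2r _ 2)// ?nnegrE ?mulr_ge0 ?powR_ge0 ?sqrtr_ge0//.
by rewrite real_normK ?num_real.
Unshelve. all: by end_near. Qed.

Definition average (s : nat -> R) n : R := n%:R^-1 * \sum_(l < n) s l.+1.

Lemma norm_average_le (s : nat -> R) n (B : R) : 0 <= B ->
  (forall l, (l <= n)%N -> `|s l| <= B) -> `|average s n| <= B.
Proof.
move=> B0 sB; rewrite /average normrM ger0_norm ?invr_ge0//.
have [->|n0] := posnP n; first by rewrite invr0 mul0r.
rewrite mulrC ler_pdivrMr ?ltr0n// (le_trans (ler_norm_sum _ _ _))//.
apply: (@le_trans _ _ (\sum_(l < n) B)); last by rewrite sumr_const card_ord mulr_natr.
by apply: ler_sum => l _; exact: sB.
Qed.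

Lemma average_change (s : nat -> R) (N n : nat) (B : R) : (0 < N)%N -> (N <= n)%N ->
  0 <= B -> (forall l, (l <= n)%N -> `|s l| <= B) ->
  `|average s n - average s N| <= 2 * (n - N)%:R / N%:R * B.
Proof.
move=> N0 Nn B0 sB.
have NR : (0 : R) < N%:R by rewrite ltr0n.
have nR : (0 : R) < n%:R by rewrite ltr0n (leq_trans N0).
pose U := \sum_(l < n - N) s (N + l).+1.
have E : \sum_(l < n) s l.+1 = \sum_(l < N) s l.+1 + U.
  have split k : \sum_(l < N + k) s l.+1 =
      \sum_(l < N) s l.+1 + \sum_(l < k) s (N + l).+1 by rewrite big_split_ord.
  by rewrite -split subnKC.
have U0 : `|U| <= (n - N)%:R * B.
  apply: (le_trans (ler_norm_sum _ _ _)).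
  apply: (@le_trans _ _ (\sum_(l < n - N) B)); last by rewrite sumr_const card_ord mulr_natl.
  by apply: ler_sum => l _; apply: sB; have := ltn_ord l; lia.
have aN : `|average s N| <= B.
  by apply: norm_average_le => // l lN; apply: sB; exact: leq_trans Nn.
have -> : average s n - average s N = n%:R^-1 * (U - (n - N)%:R * average s N).
  rewrite {1}/average E natrB// mulrBl [N%:R * average s N]mulrA mulfV ?gt_eqF// mul1r.
  rewrite /average; field; rewrite !gt_eqF//.
rewrite normrM ger0_norm ?invr_ge0 ?ler0n//.
have H : `|U - (n - N)%:R * average s N| <= 2 * (n - N)%:R * B.
  apply: (le_trans (ler_normB _ _)).
  rewrite normrM [ `|(n - N)%:R| ]ger0_norm//.
  have : (n - N)%:R * `|average s N| <= (n - N)%:R * B by rewrite ler_wpM2l.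
  lra.
have -> : 2 * (n - N)%:R / N%:R * B = N%:R^-1 * (2 * (n - N)%:R * B) by ring.
apply: ler_pM => //.
by rewrite lef_pV2 ?posrE// ler_nat.
Qed.

(** Chord bound on [0, 1] for the convex function (1 + x)^p, taken at x = 1 / k. *)
Lemma exprS_sub_le (k p : nat) : (0 < k)%N ->
  (((k.+1 ^ p - k ^ p)%N)%:R : R) <= 2 ^+ p / k%:R * (k ^ p)%:R.
Proof.
move=> k0; have kR : (1 : R) <= k%:R by rewrite ler1n.
have kR0 : (0 : R) < k%:R by rewrite ltr0n.
have kp : (k ^ p <= k.+1 ^ p)%N.
  by case: p => [|p]; [rewrite !expn0|rewrite leq_exp2r].
rewrite natrB//.
rewrite !natrX -natr1.
set x : R := k%:R in kR kR0 *; clear kp.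
have H : (x + 1) ^+ p * x <= x ^+ p * (x + 2 ^+ p - 1).
  elim: p => [|p IH]; first by rewrite !expr0; lra.
  have c0 : 0 <= 2 ^+ p - 1 :> R by rewrite subr_ge0 exprn_ege1// ler1n.
  have A0 : 0 <= x ^+ p by rewrite exprn_ge0// ltW.
  rewrite exprS -mulrA; apply: (@le_trans _ _ ((x + 1) * (x ^+ p * (x + 2 ^+ p - 1)))).
    by rewrite ler_wpM2l//; lra.
  rewrite [leLHS](_ : _ = x ^+ p * ((x + 1) * (x + 2 ^+ p - 1))); last by ring.
  rewrite [leRHS](_ : _ = x ^+ p * (x * (x + 2 * 2 ^+ p - 1))); last by rewrite !exprS; ring.
  rewrite ler_wpM2l//; nra.
rewrite mulrAC ler_pdivlMr// mulrBl.
have : 0 <= x ^+ p by rewrite exprn_ge0// ltW.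
by move: H; rewrite !mulrDr; lra.
Qed.

Lemma root_near (p k0 : nat) : (0 < p)%N ->
  \forall n \near \oo, exists2 k, (k0 <= k)%N & (k ^ p <= n < k.+1 ^ p)%N.
Proof.
move=> p0; near=> n.
have ex : exists k, (k ^ p <= n)%N by exists 0%N; rewrite exp0n.
have bd k : (k ^ p <= n)%N -> (k <= n)%N.
  apply: leq_trans; case: k => // k.
  by rewrite -(prednK p0) expnS leq_pmulr// expn_gt0.
case: (ex_maxnP ex bd) => k kn kmax; exists k.
  by apply: kmax; near: n; exact: nbhs_infty_ge.
rewrite kn/= ltnNge; apply/negP => /kmax; by rewrite ltnn.
Unshelve. all: by end_near. Qed.

(** With v^8 = k, the threshold at the checkpoint is sqrt (k^p) / v^6, while
    the average moves by at most 4 * 4^p * sqrt (k^p) / v^7 up to the next one: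
    the exponent (8 p)^-1 of the growth of [s] costs a single factor v, less
    than the two factors by which 1 / k = v^-8 beats the threshold. *)
Lemma average_lower_between (p k n : nat) (s : nat -> R) :
  let v := k%:R `^ 8^-1 in
  (0 < p)%N -> (0 < k)%N -> (k ^ p <= n < k.+1 ^ p)%N -> 8 * 4 ^+ p <= v ->
  (forall m, (m <= n)%N -> `|s m| <= n%:R `^ (8 * p%:R)^-1 * Num.sqrt n%:R) ->
  Num.sqrt (k ^ p)%:R / v ^+ 6 < `|average s (k ^ p)| ->
  Num.sqrt n%:R * n%:R `^ (- p%:R^-1) <= `|average s n|.
Proof.
move=> v p0 k0 /andP[Nn nN] pv sB gN.
set N := (k ^ p)%N in Nn gN.
have kR : (0 : R) < k%:R by rewrite ltr0n.
have pR : (0 : R) < p%:R by rewrite ltr0n.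
have v0 : 0 < v by rewrite powR_gt0.
have v8 : v ^+ 8 = k%:R by rewrite -powR_mulrn ?powR_ge0// -powRrM mulVf// powRr1// ltW.
have N0 : (0 < N)%N by rewrite expn_gt0 k0.
have n0 : (0 < n)%N by exact: leq_trans Nn.
have NR : (0 : R) < N%:R by rewrite ltr0n.
have nR : (0 : R) < n%:R by rewrite ltr0n.
have k2 : (k.+1 <= 2 * k)%N by lia.
have n2k : (n <= (2 * k) ^ p)%N.
  by apply: (leq_trans (ltnW nN)); rewrite leq_exp2r.
have q1 : 1 <= 2 ^+ p :> R by rewrite exprn_ege1// ler1n.
have q4 : (4 : R) ^+ p = 2 ^+ p * 2 ^+ p by rewrite -exprMn -natrM.
have sN0 : 0 < Num.sqrt (N%:R : R) by rewrite sqrtr_gt0.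
have sn0 : 0 < Num.sqrt (n%:R : R) by rewrite sqrtr_gt0.
have snN : Num.sqrt (n%:R : R) <= 2 ^+ p * Num.sqrt N%:R.
  have rhs0 : 0 <= 2 ^+ p * Num.sqrt (N%:R : R) by nra.
  rewrite -(@ler_pXn2r _ 2)// ?nnegrE ?rhs0 ?(ltW sn0)//.
  rewrite exprMn !sqr_sqrtr ?ler0n//.
  apply: (@le_trans _ _ (2 ^+ p * N%:R)).
    by rewrite -natrX -natrM ler_nat /N -expnMn.
  by rewrite ler_wpM2r ?ler0n//; nra.
have na : (n%:R : R) `^ (8 * p%:R)^-1 <= 2 * v.
  apply: (@le_trans _ _ (((2 * k) ^ p)%:R `^ (8 * p%:R)^-1)).
    by apply: ge0_ler_powR; rewrite ?nnegrE ?ler0n ?ler_nat// invr_ge0 mulr_ge0// ltW.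
  rewrite natrX -powR_mulrn ?ler0n// -powRrM.
  rewrite (_ : p%:R * _ = 8^-1); last by field; rewrite gt_eqF.
  rewrite natrM powRM ?ler0n// ler_wpM2r ?(ltW v0)//.
  rewrite -[leRHS]powRr1// ler_powR ?ler1n//; lra.
have B0 : 0 <= (n%:R : R) `^ (8 * p%:R)^-1 * Num.sqrt n%:R.
  by rewrite mulr_ge0 ?powR_ge0// ltW.
have change := average_change N0 Nn B0 sB.
have gap : ((n - N)%:R : R) <= 2 ^+ p / v ^+ 8 * N%:R.
  rewrite v8; apply: le_trans (exprS_sub_le p k0).
  by rewrite ler_nat leq_sub2r// ltnW.
have {}change : `|average s n - average s N| <= Num.sqrt N%:R / v ^+ 6 / 2.
  apply: (le_trans change).
  apply: (@le_trans _ _ (2 * (2 ^+ p / v ^+ 8) * ((2 * v) * (2 ^+ p * Num.sqrt N%:R)))).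
    apply: ler_pM => //.
    - by rewrite ler_pdivrMr// -mulrA ler_wpM2l.
    - by apply: ler_pM => //; exact: powR_ge0.
  rewrite (_ : _ * _ = (8 * 4 ^+ p / v) * (Num.sqrt N%:R / v ^+ 6 / 2)); last first.
    by rewrite q4; field; rewrite gt_eqF.
  rewrite ler_piMl ?divr_ge0 ?exprn_ge0 ?sqrtr_ge0//; first exact: ltW.
  by rewrite ler_pdivrMr// mul1r.
have low : Num.sqrt N%:R / v ^+ 6 / 2 <= `|average s n|.
  have := ler_normD (average s N - average s n) (average s n).
  rewrite subrK distrC => h; lra.
apply: le_trans low.
have nk : (n%:R : R) `^ (- p%:R^-1) <= (v ^+ 8)^-1.
  rewrite powRN lef_pV2 ?posrE ?exprn_gt0 ?powR_gt0// v8.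
  have -> : (k%:R : R) = N%:R `^ p%:R^-1.
    by rewrite /N natrX -powR_mulrn ?ler0n// -powRrM mulfV ?gt_eqF// powRr1// ltW.
  apply: ge0_ler_powR.
  - by rewrite invr_ge0 ltW.
  - by rewrite nnegrE.
  - by rewrite nnegrE.
  - by rewrite ler_nat.
apply: (@le_trans _ _ ((2 ^+ p * Num.sqrt N%:R) * (v ^+ 8)^-1)).
  by apply: ler_pM => //; exact: powR_ge0.
rewrite (_ : _ * _ = (2 * 2 ^+ p / v ^+ 2) * (Num.sqrt N%:R / v ^+ 6 / 2)); last first.
  by field; rewrite gt_eqF.
rewrite ler_piMl ?divr_ge0 ?exprn_ge0 ?sqrtr_ge0//; first exact: ltW.
rewrite ler_pdivrMr ?exprn_gt0// mul1r.
move: pv; rewrite q4; move: q1; set q := 2 ^+ p => q1 pv.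
have vq : 8 * q <= v by nra.
nra.
Qed.

End growth.

(** * The two almost sure bounds *)

Section assembly.
Context (R : realType) (disp : measure_display) (T : measurableType disp).
Variable P : probability T R.
Variable d : nat.
Local Notation V := (g_sigma_algebraType (@open 'cV[R]_d)).
Variable X : nat -> T -> 'cV[R]_d.
Hypothesis hX : iid_random_vectors P X.

Lemma walk_increment (i : 'I_d) m w :
  walk X m w i 0 = increment X (fun x : V => (x : 'cV[R]_d) i 0) 0 m w.
Proof. by rewrite walkE summxE. Qed.

Lemma centre_average (i : 'I_d) n w :
  centre_of_mass X n w i 0 = average (fun l => walk X l w i 0) n.
Proof. by rewrite /centre_of_mass !mxE summxE big_add1 big_mkord. Qed.

Lemma enorm_sqr (x : 'cV[R]_d) : enorm x ^+ 2 = \sum_(i < d) x i 0 ^+ 2.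
Proof. by rewrite sqr_sqrtr// sumr_ge0// => i _; exact: sqr_ge0. Qed.

Lemma enorm_ge (x : 'cV[R]_d) i : `|x i 0| <= enorm x.
Proof.
rewrite -(@ler_pXn2r _ 2)// ?nnegrE ?sqrtr_ge0// enorm_sqr real_normK ?num_real//.
by rewrite (bigD1 i)//= lerDl sumr_ge0// => j _; exact: sqr_ge0.
Qed.

Lemma enorm_le (x : 'cV[R]_d) (B : R) : 0 <= B -> (forall i, `|x i 0| <= B) ->
  enorm x <= d%:R * B.
Proof.
move=> B0 xB; rewrite -(@ler_pXn2r _ 2)// ?nnegrE ?sqrtr_ge0 ?mulr_ge0// enorm_sqr.
apply: (@le_trans _ _ (\sum_(i < d) B ^+ 2)).
  apply: ler_sum => i _; rewrite -(real_normK (num_real (x i 0))).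
  by rewrite ler_pXn2r ?nnegrE.
rewrite sumr_const card_ord -[leLHS]mulr_natl exprMn ler_wpM2r ?sqr_ge0// -natrX ler_nat.
by clear; case: d => // m; rewrite leq_pmulr.
Qed.

Hypothesis hsq : ('E_P[fun w => (enorm (X 0%N w) ^+ 2)%R] < +oo)%E.

Lemma integrable_coord_sqr i : integrableR P (fun w => X 0%N w i 0 ^+ 2).
Proof.
have mi j := measurable_step_coord hX 0 j.
have ms : measurable_fun setT (fun w => enorm (X 0%N w) ^+ 2).
  under eq_fun do rewrite enorm_sqr.
  by apply: measurable_sum => j; exact: measurable_funX.
have is2 : integrableR P (fun w => enorm (X 0%N w) ^+ 2).
  apply/integrableP; split; first exact/measurable_EFinP.
  apply: le_lt_trans hsq; rewrite unlock.
  rewrite le_eqVlt; apply/orP; left; apply/eqP; apply: eq_integral => w _.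
  by rewrite /= ger0_norm// sqr_ge0.
apply: (integrableR_le _ is2); first exact: measurable_funX.
move=> w; rewrite ger0_norm ?sqr_ge0// enorm_sqr (bigD1 i)//= lerDl.
by apply: sumr_ge0 => j _; exact: sqr_ge0.
Qed.

Hypothesis hmean : forall k : 'I_d, ('E_P[fun w => (X 0%N w k 0)%R] = 0)%E.

Lemma Ex_coord i : Ex P (fun w => X 0%N w i 0) = 0.
Proof. by have := hmean i; rewrite unlock /Ex /Rintegral => ->. Qed.

Lemma second_moment_mxE i j :
  second_moment_mx P (X 0%N) i j = Ex P (fun w => X 0%N w i 0 * X 0%N w j 0).
Proof.
rewrite mxE unlock /Ex /Rintegral; congr fine; apply: eq_integral => w _.
by rewrite mxE big_ord1 mxE.
Qed.

Lemma ae_walk_growth (a : R) : 0 < a ->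
  {ae P, forall w, forall i : 'I_d, \forall n \near \oo, forall m, (m <= n)%N ->
    `|walk X m w i 0| <= n%:R `^ a * Num.sqrt n%:R}.
Proof.
move=> a0; apply: filter_forall => i.
pose f (x : V) : R := (x : 'cV[R]_d) i 0.
have mf : measurable_fun setT f by exact: measurable_coord.
have := @ae_max_increment _ _ _ P d X hX f mf (integrable_coord_sqr i) (Ex_coord i).
apply: filterS => w Hw.
apply: (@dyadic_bound_powR R (fun m => walk X m w i 0) a a0).
by under eq_near do under eq_forall do rewrite walk_increment.
Qed.

Section two_coordinates.
Variables i0 i1 : 'I_d.
Hypothesis i01 : i0 != i1.
Hypothesis hM : positive_definite (second_moment_mx P (X 0%N)).

Let A w := X 0%N w i0 0.
Let B w := X 0%N w i1 0.

Lemma quadratic_form_gt0 a b : (a != 0) || (b != 0) ->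
  0 < quadratic_form P A B a b.
Proof.
move=> ab0; have [_ posM] := hM; set M := second_moment_mx P (X 0%N) in posM.
pose v : 'cV[R]_d := a *: delta_mx i0 0 + b *: delta_mx i1 0.
have v0 : v != 0.
  apply: contraTneq ab0 => v0; rewrite negb_or !negbK.
  have := congr1 (fun x : 'cV[R]_d => x i0 0) v0.
  have := congr1 (fun x : 'cV[R]_d => x i1 0) v0.
  rewrite /v !mxE !eqxx (negbTE i01) eq_sym (negbTE i01)/=.
  by rewrite !mulr0 !mulr1 addr0 add0r => -> ->; rewrite eqxx.
have := posM v v0.
have Mij i j : (delta_mx i 0 : 'cV[R]_d)^T *m M *m delta_mx j 0 = (M i j)%:M.
  rewrite trmx_delta -rowE -colE; apply/matrixP => x y.
  by rewrite !ord1 !mxE eqxx mulr1n.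
suff -> : (v^T *m M *m v) 0 0 = quadratic_form P A B a b by [].
have -> : v^T = a *: (delta_mx i0 0)^T + b *: (delta_mx i1 0)^T.
  by rewrite /v linearD !linearZ.
rewrite /v !mulmxDl !mulmxDr -!scalemxAl -!scalemxAr !Mij.
rewrite /M !second_moment_mxE !mxE eqxx !mulr1n /quadratic_form /A /B.
have -> : (fun w => X 0%N w i1 0 * X 0%N w i0 0) =
    (fun w => X 0%N w i0 0 * X 0%N w i1 0) by apply/funext => w; rewrite mulrC.
ring.
Qed.

(** Positivity of the quadratic form at (1, 0) and at (- r, p), where p is the
    variance of the first coordinate and r the covariance. *)
Lemma covariance_det_pos :
  0 < Ex P (fun w => A w ^+ 2) /\
  Ex P (fun w => A w * B w) ^+ 2 < Ex P (fun w => A w ^+ 2) * Ex P (fun w => B w ^+ 2).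
Proof.
have p0 : 0 < Ex P (fun w => A w ^+ 2).
  have := @quadratic_form_gt0 1 0; rewrite oner_neq0 => /(_ isT).
  by rewrite /quadratic_form; lra.
split=> //.
set p := Ex P (fun w => A w ^+ 2) in p0 *; set r := Ex P (fun w => A w * B w).
have := @quadratic_form_gt0 (- r) p; rewrite (gt_eqF p0) orbT => /(_ isT).
rewrite /quadratic_form -/p -/r; set q := Ex P (fun w => B w ^+ 2).
rewrite (_ : _ + _ = p * (p * q - r ^+ 2)); last by ring.
by rewrite pmulr_rgt0// subr_gt0.
Qed.

(** Borel-Cantelli along k^p.  With v^8 = k the small-ball radius is
    x sqrt (k^p) for x = v^-6, and x^2 = k^(-3/2).  As p >= 2, the term k^(-p)
    is smaller. *)
Lemma ae_checkpoints (p : nat) : (2 <= p)%N ->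
  {ae P, forall w, \forall k \near \oo,
    Num.sqrt (k ^ p)%:R / (k%:R `^ 8^-1) ^+ 6 < `|centre_of_mass X (k ^ p) w i0 0| \/
    Num.sqrt (k ^ p)%:R / (k%:R `^ 8^-1) ^+ 6 < `|centre_of_mass X (k ^ p) w i1 0|}.
Proof.
move=> p2.
have mX i := measurable_step_coord hX 0 i.
have [pA dAB] := covariance_det_pos.
have [c [de [c0 de0 decay]]] := characteristic_decay (mX i0) (mX i1)
  (integrable_coord_sqr i0) (integrable_coord_sqr i1) (Ex_coord i0) (Ex_coord i1) pA dAB.
have [C C0 HC] := small_centre_of_mass_prob hX c0 de0 decay.
pose v k : R := k%:R `^ 8^-1.
pose E k := [set w | `|centre_of_mass X (k ^ p) w i0 0| <= Num.sqrt (k ^ p)%:R * (v k ^+ 6)^-1 /\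
                     `|centre_of_mass X (k ^ p) w i1 0| <= Num.sqrt (k ^ p)%:R * (v k ^+ 6)^-1].
have mG n i : measurable_fun setT (fun w => centre_of_mass X n w i 0).
  exact: (measurable_centre_coord hX).
have mE k : measurable (E k).
  have -> : E k = [set w | `|centre_of_mass X (k ^ p) w i0 0| <= Num.sqrt (k ^ p)%:R * (v k ^+ 6)^-1] `&`
     [set w | `|centre_of_mass X (k ^ p) w i1 0| <= Num.sqrt (k ^ p)%:R * (v k ^+ 6)^-1] by [].
  by apply: measurableI; apply: measurable_le_set => //; exact: measurableT_comp.
have : {ae P, forall w, \1_(E k.+1) w @[k --> \oo] --> (0 : R)}.
  apply: (@ae_cvg0 _ _ _ P (fun k => \1_(E k.+1)) (2 * C * 4)).
  - by move=> k; exact: integrableR_indic.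
  - by move=> k w; rewrite indicE ler0n.
  - move=> n; have C2 : 0 <= 2 * C by rewrite mulr_ge0// ltW.
    apply: le_trans (ler_wpM2l C2 (sum_inv_sqrt3_le R n)).
    rewrite mulr_sumr; apply: ler_sum => k _; rewrite Ex_indic//.
    have kR : (0 : R) < k.+1%:R by rewrite ltr0n.
    have v0 : 0 < v k.+1 by rewrite powR_gt0.
    have v8 : v k.+1 ^+ 8 = k.+1%:R.
      by rewrite -powR_mulrn ?powR_ge0// -powRrM mulVf// powRr1// ltW.
    have v1 : 1 <= v k.+1.
      have := @ler_powR R k.+1%:R; rewrite ler1n => /(_ isT 0 8^-1).
      by rewrite powRr0; apply; rewrite invr_ge0.
    apply: (le_trans (HC (k.+1 ^ p)%N (v k.+1 ^+ 6)^-1 _ _)).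
    + by rewrite expn_gt0.
    + by rewrite invr_gt0 exprn_gt0.
    have -> : Num.sqrt (k.+1%:R : R) = v k.+1 ^+ 4.
      rewrite -v8 (_ : v k.+1 ^+ 8 = (v k.+1 ^+ 4) ^+ 2); last by rewrite -exprM.
      by rewrite sqrtr_sqr ger0_norm// exprn_ge0// ltW.
    rewrite exprVn -!exprM -mulrA [leRHS]mulrCA ler_wpM2l ?(ltW C0)//.
    rewrite mulr_natl mulr2n lerD// lef_pV2 ?posrE ?exprn_gt0 ?ltr0n ?expn_gt0//.
    rewrite natrX -v8 -exprM ler_weXn2l//.
    by apply: (@leq_trans (8 * 2)%N); rewrite ?leq_mul2l.
apply: filterS => w Zw.
have Zn : \forall k \near \oo, (\1_(E k.+1) w : R) < 1.
  by apply: (cvgr_lt 0 Zw); exact: ltr01.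
have [k0 _ Hk0] := Zn.
exists k0.+1 => // -[//|k] /= k0k.
have := Hk0 k k0k; rewrite /= indicE; case: (boolP (w \in E k.+1)); first by rewrite ltxx.
rewrite notin_setE /E/= => nE _.
have [h|h] := ltP (Num.sqrt (k.+1 ^ p)%:R / v k.+1 ^+ 6) `|centre_of_mass X (k.+1 ^ p) w i0 0|.
  by left.
have [h'|h'] := ltP (Num.sqrt (k.+1 ^ p)%:R / v k.+1 ^+ 6) `|centre_of_mass X (k.+1 ^ p) w i1 0|.
  by right.
by case: nE.
Qed.

Lemma ae_enorm_bounds (p : nat) : (2 <= p)%N ->
  {ae P, forall w, \forall n \near \oo,
    Num.sqrt n%:R * n%:R `^ (- p%:R^-1) <= enorm (centre_of_mass X n w) /\
    enorm (centre_of_mass X n w) <= d%:R * (n%:R `^ p%:R^-1 * Num.sqrt n%:R)}.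
Proof.
move=> p2; have p0 : (0 < p)%N by exact: ltnW.
have pR : (0 : R) < p%:R by rewrite ltr0n.
have e0 : (0 : R) < (8 * p%:R)^-1 by rewrite invr_gt0 mulr_gt0.
have u0 : (0 : R) < p%:R^-1 by rewrite invr_gt0.
have := ae_walk_growth u0; have := ae_walk_growth e0.
have := ae_checkpoints p2.
apply: filterS3 => w [k0 _ check] growth1 growth2.
have eighth0 : (0 : R) < 8^-1 by rewrite invr_gt0.
have [k1 _ Hk1] := @powR_near_ge R (8 * 4 ^+ p) _ eighth0.
near=> n.
have [k] : exists2 k, (maxn 1 (maxn k0 k1) <= k)%N & (k ^ p <= n < k.+1 ^ p)%N.
  by near: n; exact: root_near.
rewrite !geq_max => /and3P[k1' kk0 kk1] kn.
split; last first.
  apply: enorm_le; first by rewrite mulr_ge0 ?powR_ge0 ?sqrtr_ge0.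
  move=> i; rewrite centre_average; apply: norm_average_le.
    by rewrite mulr_ge0 ?powR_ge0 ?sqrtr_ge0.
  by move: i; near: n; apply: filter_forall => i; exact: growth2.
have bd i : forall m, (m <= n)%N -> `|walk X m w i 0| <= n%:R `^ (8 * p%:R)^-1 * Num.sqrt n%:R.
  by move: i; near: n; apply: filter_forall => i; exact: growth1.
have low i : Num.sqrt (k ^ p)%:R / (k%:R `^ 8^-1) ^+ 6 < `|centre_of_mass X (k ^ p) w i 0| ->
    Num.sqrt n%:R * n%:R `^ (- p%:R^-1) <= enorm (centre_of_mass X n w).
  move=> h; apply: le_trans (enorm_ge _ i); rewrite centre_average.
  rewrite centre_average in h.
  by apply: (average_lower_between p0 k1' kn) h; [exact: Hk1|exact: bd].
by case: (check k kk0) => h; exact: low h.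
Unshelve. all: by end_near. Qed.


End two_coordinates.
End assembly.

(** The condition d^p <= n makes the contribution of the constant [d] at most
    1 / p. *)
Lemma log_ratio_bound (R : realType) (d p n : nat) (e : R) :
  (0 < d)%N -> (0 < p)%N -> (1 < n)%N -> (d ^ p <= n)%N ->
  Num.sqrt n%:R * n%:R `^ (- p%:R^-1) <= e ->
  e <= d%:R * (n%:R `^ p%:R^-1 * Num.sqrt n%:R) ->
  `|2^-1 - ln e / ln n%:R| <= 2 / p%:R.
Proof.
move=> d0 p0 n1 dn low up.
have nR : (0 : R) < n%:R by rewrite ltr0n ltnW.
have dR : (0 : R) < d%:R by rewrite ltr0n.
have pR : (0 : R) < p%:R by rewrite ltr0n.
have L0 : 0 < ln (n%:R : R) by rewrite ln_gt0// ltr1n.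
have lnsqrt : ln (Num.sqrt n%:R) = 2^-1 * ln n%:R :> R.
  by rewrite -powR12_sqrt ?ler0n// ln_powR.
have s0 : 0 < Num.sqrt (n%:R : R) by rewrite sqrtr_gt0.
have a0 b : 0 < (n%:R : R) `^ b by rewrite powR_gt0.
have e0 : 0 < e by apply: lt_le_trans low; rewrite mulr_gt0.
have lnd : ln (d%:R : R) <= p%:R^-1 * ln n%:R.
  rewrite mulrC ler_pdivlMr// mulr_natr -lnXn// ler_ln ?posrE ?exprn_gt0//.
  by rewrite -natrX ler_nat.
have lo : 2^-1 * ln n%:R - p%:R^-1 * ln n%:R <= ln e.
  move: low; rewrite -ler_ln ?posrE ?mulr_gt0// lnM ?posrE// lnsqrt ln_powR.
  by rewrite mulNr.
have hi : ln e <= 2 * p%:R^-1 * ln n%:R + 2^-1 * ln n%:R.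
  move: up; rewrite -ler_ln ?posrE ?mulr_gt0// !lnM ?posrE ?mulr_gt0// lnsqrt ln_powR.
  lra.
set L := ln n%:R in L0 lo hi *; set q := p%:R^-1 in lo hi *.
have q0 : 0 < q by rewrite invr_gt0.
rewrite ler_norml; apply/andP; split.
- rewrite lerBrDr addrC lerBlDr ler_pdivrMr//; lra.
- rewrite lerBlDr -lerBlDl ler_pdivlMr//; nra.
Qed.

(* X 0 is the generic vector X, and X 1, X 2, ... are the steps.  Since
   ln 0 = 0 in the library, the quotient is 0 whenever the centre of mass
   vanishes; such n are thus as incompatible with the limit 1/2 as under the
   convention log 0 = -oo. *)
Theorem theorem7p3p1 (R : realType) (disp : measure_display)
    (T : measurableType disp) (P : probability T R)
    (d : nat) (hd : (2 <= d)%N)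
    (X : nat -> T -> 'cV[R]_d) (hX : iid_random_vectors P X)
    (hnondeg : nondegenerate_distribution P (X 0%N))
    (hlattice : lattice_distribution P (X 0%N))
    (H : 'M[R]_d) (hH : 0 < `|\det H|)
    (hmin : minimal_subgroup P (X 0%N) (lattice_of H))
    (hsq : ('E_P[fun w => (enorm (X 0%N w) ^+ 2)%R] < +oo)%E)
    (hmean : forall k : 'I_d, ('E_P[fun w => (X 0%N w k 0)%R] = 0)%E)
    (hM : positive_definite (second_moment_mx P (X 0%N))) :
  {ae P, forall w,
    ln (enorm (centre_of_mass X n w)) / ln n%:R @[n --> \oo] --> (2^-1 : R)}.
Proof.
pose i0 : 'I_d := Ordinal (ltnW hd); pose i1 : 'I_d := Ordinal hd.
have i01 : i0 != i1 by [].
have bounds (q : nat) := ae_enorm_bounds hX hsq hmean i01 hM (isT : (2 <= q.+2)%N).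
have := ae_foralln bounds; apply: filterS => w Hw.
apply/cvgrPdist_le => e e0.
pose q := Num.truncn (2 / e).
have qe : 2 / q.+2%:R <= e.
  have h : 2 / e < q.+1%:R by exact: truncnS_gt.
  by rewrite ler_pdivrMr ?ltr0n// -ler_pdivrMl// mulrC (le_trans (ltW h))// ler_nat.
near=> n.
have [lo hi] : Num.sqrt n%:R * n%:R `^ (- q.+2%:R^-1) <= enorm (centre_of_mass X n w) /\
   enorm (centre_of_mass X n w) <= d%:R * (n%:R `^ q.+2%:R^-1 * Num.sqrt n%:R).
  by near: n; exact: Hw.
apply: le_trans qe; apply: (@log_ratio_bound R d) lo hi => //; first exact: ltnW.
- by near: n; exact: nbhs_infty_gt.
- by near: n; exact: nbhs_infty_ge.
Unshelve. all: by end_near. Qed.
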